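(* For all sufficiently large $m\in\mathbb{N}$, the wavelet system $X(G^{(m)})$ is a frame of $L_2(\mathbb{R})$ with some frame bounds $A_m$ and $B_m$, where these bounds satisfy $$\lim_{m\to\infty}A_m=\lim_{m\to\infty}B_m=1.$$
   Context: Put $j_m:=0$ if $m$ is even and $j_m:=1$ if $m$ is odd. For integers $1\le\ell\le m$ let $$G_{m,\ell}(x):=C_{m,\ell}\exp\left(-\frac{12x^2}{2m-\ell}\right),\qquad C_{m,\ell}:=\sqrt{\frac{6}{\pi}}\;\frac{\sqrt{\binom{m}{\ell}}}{\sqrt{m-\ell/2}\cdot4^\ell},$$ let $G_\ell^{(m)}(x):=\left(\frac{d^\ell}{dx^\ell}G_{m,\ell}\right)\!\left(x-\frac{j_m}{2}\right)$, and $G^{(m)}:=\{G_1^{(m)},\ldots,G_m^{(m)}\}$. For $\Psi=\{\psi_1,\ldots,\psi_r\}\subset L_2(\mathbb{R})$ the wavelet system generated by $\Psi$ is $$X(\Psi):=\{2^{n/2}\psi_\ell(2^n\cdot-k):1\le\ell\le r;\ n,k\in\mathbb{Z}\}.$$ A family $\{f_j\}_{j\in J}\subset L_2(\mathbb{R})$ is a frame with bounds $A,B$ (with $0<A\le B<\infty$) if $A\|f\|^2\le\sum_{j\in J}|\langle f,f_j\rangle|^2\le B\|f\|^2$ for all $f\in L_2(\mathbb{R})$. *)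

(* Defs.v *)
From HB Require Import structures.
From mathcomp Require Import all_boot all_order all_algebra.
From mathcomp Require Import all_classical all_reals all_analysis.
From mathcomp Require Import complex.

Set Implicit Arguments.
Unset Strict Implicit.
Unset Printing Implicit Defensive.

Import Order.TTheory GRing.Theory Num.Theory.
Import numFieldNormedType.Exports.
Import ComplexField.Normc.

Local Open Scope classical_set_scope.
Local Open Scope ring_scope.
Local Open Scope complex_scope.

(* Elements of L_2(R) are represented by complex-valued functions rather than
   by their a.e.-equivalence classes: the inner product and the norm below do
   not depend on the representative. *)
Section L2.
Context {R : realType}.
Implicit Types f g : R -> R[i].

Definition L2 f : Prop :=
  (fun x => complex.Re (f x)) \in Lfun (@lebesgue_measure R) 2%:E /\
  (fun x => complex.Im (f x)) \in Lfun (@lebesgue_measure R) 2%:E.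

Definition L2_inner f g : R[i] :=
  Rintegral (@lebesgue_measure R) setT (fun x => complex.Re (f x * (g x)^*)) +i*
  Rintegral (@lebesgue_measure R) setT (fun x => complex.Im (f x * (g x)^*)).

Definition L2_norm f : \bar R :=
  ('N[@lebesgue_measure R]_2%:E[(fun x => (normc (f x))%:E)])%E.

Definition is_frame (J : choiceType) (F : J -> R -> R[i]) (A B : R) : Prop :=
  [/\ 0 < A, A <= B, forall j, L2 (F j) &
    forall f, L2 f ->
      (A%:E * L2_norm f ^+ 2
         <= \esum_(j in [set: J]) (normc (L2_inner f (F j)) ^+ 2)%:E /\
       \esum_(j in [set: J]) (normc (L2_inner f (F j)) ^+ 2)%:E
         <= B%:E * L2_norm f ^+ 2)%E].

(* X(Psi), as a family indexed by the triples (l, n, k). *)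
Definition wavelet_system (r : nat) (Psi : 'I_r -> R -> R[i])
    (j : 'I_r * int * int) : R -> R[i] :=
  let: (l, n, k) := j in
  fun x => (2 `^ (n%:~R / 2))%:C * Psi l (2 ^ n * x - k%:~R).

End L2.

Section GaussianGenerators.
Context (R : realType).

Definition Gconst (m l : nat) : R :=
  Num.sqrt (6 / pi) *
  (Num.sqrt 'C(m, l)%:R / (Num.sqrt (m%:R - l%:R / 2) * 4 ^+ l)).

Definition Gauss (m l : nat) (x : R) : R :=
  Gconst m l * expR (- (12 * x ^+ 2 / (2 * m%:R - l%:R))).

Definition Gderiv (m l : nat) (x : R) : R :=
  derive1n l (Gauss m l) (x - (odd m)%:R / 2).

(* The index i : 'I_m stands for l = i + 1, so that l ranges over 1, ..., m. *)
Definition Gsystem (m : nat) (i : 'I_m) (x : R) : R[i] := (Gderiv m i.+1 x)%:C.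

End GaussianGenerators.

(* Main.v *)
Require Import Defs.
From HB Require Import structures.
From mathcomp Require Import all_boot all_order all_algebra.
From mathcomp Require Import all_classical all_reals all_analysis.
From mathcomp Require Import measurable_realfun.
From mathcomp Require Import complex.
From mathcomp Require Import ring lra zify.

(** Write [G_l] on the Fourier side.  With [t = w^2 / 16], the squared moduli of
    the transforms of [G_1, ..., G_m] add up to
    [S(t) = (e^(-4t/3) + t e^(-2t/3))^m - e^(-4mt/3)], and
    [S(t) = (e^(-mt/3) - e^(-4mt/3)) + O(1/m)] with an error that is summable over
    dyadic scales.  The main term is [u(t) - u(4t)] for [u(t) = e^(-mt/3)], so its
    sum over [t 4^n], [n] in [Z], telescopes to [1]: the continuous-time frame
    operator tends to the identity.

    The sum over the lattice of translates is a Riemann sum of [F^2], where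
    [F] is a convolution of the signal with a dilate of [G_l]; it differs from the
    integral by at most [e int F^2 + (d^2/e) int F'^2], [d] being the mesh.  On the
    Fourier side [d^2 F'^2] amounts to an extra factor [16 t], and
    [t S(t)] sums to [O(1/m)] over the scales.  With [e = m^(-1/2)] the total
    aliasing error is [O(m^(-1/2))].

    All functions may be taken real, and the Fourier transform is replaced by
    [h |-> int h(x) cos(x y + phi) dx].  For [cos (2 phi) = 0] this is, up to a
    constant, the Hartley transform, which satisfies Plancherel's formula on real
    functions. *)

Import Order.TTheory GRing.Theory Num.Theory.
Import numFieldNormedType.Exports.
Import ComplexField.Normc.

Set Implicit Arguments.
Unset Strict Implicit.
Unset Printing Implicit Defensive.

Local Open Scope classical_set_scope.
Local Open Scope ring_scope.

(** * Real-valued Lebesgue integrals *)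

(** The constants of the generators make the l-th squared transform a term of a binomial expansion.
    The base of that expansion agrees with e^(-t/3) to first order, since 1 - 4t/3 + t = 1 - t/3, so
    the m-th powers differ by at most m t^2 e^(-(m-1)t/6). As there are infinitely many scales,
    smallness at each of them is not enough: this bound is in turn at most O(1/m) times a difference
    between the levels t and 4t, and such differences telescope. Plancherel's formula is applied
    twice for each signal: to the signal, and to its transform multiplied by a power and a Gaussian,
    because the wavelet coefficients of one scale are samples of the transform of that product. The
    formula is stated for almost everywhere continuous functions because the signals treated first
    are continuous functions cut off at the ends of an interval. The bounds reach all of L2 by
    density, the upper one first: it controls the approximation error in the lower one. *)

Lemma cvg_EFinr {R : realFieldType} {T : Type} (F : set_system T) {FF : Filter F}
  (u : T -> R) (l : R) : u x @[x --> F] --> l -> (u x)%:E @[x --> F] --> l%:E.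
Proof. by move=> ul; apply: cvg_EFin => //; exact: nearW. Qed.

Section RealIntegral.
Context {R : realType}.
Local Notation mu := (@lebesgue_measure R).
Implicit Types (f g h : R -> R) (c : R).

Definition integrableR f : Prop := mu.-integrable setT (EFin \o f).

Definition intR f : R := \int[mu]_x f x.

Lemma integrableR_meas f : integrableR f -> measurable_fun setT f.
Proof. by move=> /measurable_int /measurable_EFinP. Qed.

Lemma intRE f : integrableR f -> (\int[mu]_x (f x)%:E)%E = (intR f)%:E.
Proof. by move=> fi; rewrite /intR /Rintegral fineK//; apply: integrable_fin_num. Qed.

Lemma eq_integrableR f g : f =1 g -> integrableR f -> integrableR g.
Proof. by move=> /funext ->. Qed.

Lemma eq_intR f g : f =1 g -> intR f = intR g.
Proof. by move=> /funext ->. Qed.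

Lemma integrableRD f g : integrableR f -> integrableR g ->
  integrableR (fun x => f x + g x).
Proof. by move=> fi gi; exact: (integrableD measurableT fi gi). Qed.

Lemma integrableRZ c f : integrableR f -> integrableR (fun x => c * f x).
Proof. by move=> fi; exact: (integrableZl measurableT c fi). Qed.

Lemma integrableRN f : integrableR f -> integrableR (fun x => - f x).
Proof. by move=> fi; exact: (integrableN fi). Qed.

Lemma integrableRB f g : integrableR f -> integrableR g ->
  integrableR (fun x => f x - g x).
Proof. by move=> fi gi; apply: integrableRD => //; exact: integrableRN. Qed.

Lemma integrableR_norm f : integrableR f -> integrableR (fun x => `|f x|).
Proof. by move=> fi; exact: (integrable_abse fi). Qed.

Lemma le_integrableR f g : measurable_fun setT f ->
  (forall x, `|f x| <= g x) -> integrableR g -> integrableR f.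
Proof.
move=> mf fg gi; apply: le_integrable gi => //.
  exact/measurable_EFinP.
by move=> x _; rewrite /= lee_fin (le_trans (fg x))// ler_norm.
Qed.

Lemma integrableRM f g c : integrableR f -> measurable_fun setT g ->
  (forall x, `|g x| <= c) -> integrableR (fun x => f x * g x).
Proof.
move=> fi mg gc; apply: (@le_integrableR _ (fun x => c * `|f x|)).
- by apply: measurable_funM => //; exact: integrableR_meas.
- by move=> x; rewrite normrM mulrC ler_wpM2r.
- by apply: integrableRZ; exact: integrableR_norm.
Qed.

Lemma integrableR0 : integrableR (fun=> 0).
Proof. exact: integrable0. Qed.

Lemma intRD f g : integrableR f -> integrableR g ->
  intR (fun x => f x + g x) = intR f + intR g.
Proof. by move=> fi gi; rewrite /intR RintegralD. Qed.

Lemma intRB f g : integrableR f -> integrableR g ->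
  intR (fun x => f x - g x) = intR f - intR g.
Proof. by move=> fi gi; rewrite /intR RintegralB. Qed.

Lemma intRZ c f : integrableR f -> intR (fun x => c * f x) = c * intR f.
Proof. by move=> fi; rewrite /intR RintegralZl. Qed.

Lemma intR0 : intR (fun=> 0) = 0.
Proof. by rewrite /intR /Rintegral integral0. Qed.

Lemma intR_ge0 f : (forall x, 0 <= f x) -> 0 <= intR f.
Proof. by move=> f0; apply: Rintegral_ge0. Qed.

Lemma le_intR f g : integrableR f -> integrableR g ->
  (forall x, f x <= g x) -> intR f <= intR g.
Proof. by move=> fi gi fg; apply: le_Rintegral. Qed.

Lemma le_norm_intR f : integrableR f -> `|intR f| <= intR (fun x => `|f x|).
Proof. by move=> fi; apply: le_normr_Rintegral. Qed.

Lemma integrableR_sum (I : Type) (s : seq I) (F : I -> R -> R) :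
  (forall i, integrableR (F i)) -> integrableR (fun x => \sum_(i <- s) F i x).
Proof.
move=> Fi; elim: s => [|i s IH].
  by apply: eq_integrableR integrableR0 => x; rewrite big_nil.
by apply: eq_integrableR (integrableRD (Fi i) IH) => x; rewrite big_cons.
Qed.

Lemma intR_sum (I : Type) (s : seq I) (F : I -> R -> R) :
  (forall i, integrableR (F i)) ->
  intR (fun x => \sum_(i <- s) F i x) = \sum_(i <- s) intR (F i).
Proof.
move=> Fi; elim: s => [|i s IH].
  by rewrite big_nil -[RHS]intR0; apply: eq_intR => x; rewrite big_nil.
rewrite big_cons -IH -intRD//; last exact: integrableR_sum.
by apply: eq_intR => x; rewrite big_cons.
Qed.

Lemma intR_dominated (F : nat -> R -> R) f g :
  (forall n, measurable_fun setT (F n)) -> measurable_fun setT f ->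
  {ae mu, forall x, F n x @[n --> \oo] --> f x} ->
  integrableR g -> (forall n x, `|F n x| <= g x) ->
  integrableR f /\ intR (F n) @[n --> \oo] --> intR f.
Proof.
move=> mF mf Ff gi Fg.
have Fi n : integrableR (F n) by apply: le_integrableR gi.
have [|||||fi _ cvg] := @dominated_convergence _ _ _ mu setT measurableT
    (fun n => EFin \o F n) (EFin \o f) (EFin \o g).
- by move=> n; apply/measurable_EFinP; exact: mF.
- by apply/measurable_EFinP; exact: mf.
- move: Ff; apply: filterS; first exact: (ae_filter_ringOfSetsType mu).
  by move=> x Fx _; exact: cvg_EFinr.
- exact: gi.
- by apply: aeW => x n _; rewrite /= lee_fin.
split => //.
apply/fine_cvg.
rewrite -intRE//; apply: cvg_trans cvg.
Qed.

(** Integrability of the limit is part of the conclusion: this is how the square of a transform, not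
    known to be integrable beforehand, is shown to be so. *)
Lemma intR_monotone (F : nat -> R -> R) f c :
  (forall n, integrableR (F n)) -> (forall n x, 0 <= F n x) ->
  (forall x, {homo F^~ x : n m / (n <= m)%N >-> n <= m}) ->
  (forall x, F n x @[n --> \oo] --> f x) ->
  intR (F n) @[n --> \oo] --> c ->
  integrableR f /\ intR f = c.
Proof.
move=> Fi F0 ndF Ff Fc.
have limF x : limn (fun n => (F n x)%:E) = (f x)%:E.
  by apply/cvg_lim => //; apply: cvg_EFinr; exact: Ff.
have cvg := @cvg_monotone_convergence _ _ _ mu setT measurableT
  (fun n x => (F n x)%:E)
  (fun n => measurable_int mu (Fi n))
  (fun n x _ => F0 n x) (fun x _ n m nm => ndF x n m nm).
have : (\int[mu]_x (f x)%:E)%E = c%:E.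
  under eq_integral do rewrite -limF.
  rewrite -[RHS](_ : limn (fun n => (intR (F n))%:E) = _); last first.
    by apply/cvg_lim => //; apply: cvg_EFinr.
  apply/esym/cvg_lim => //; apply: cvg_trans cvg.
  by apply: near_eq_cvg; apply: nearW => n /=; rewrite intRE.
move=> intf.
have mf : measurable_fun setT f.
  apply: (@measurable_fun_cvg _ _ _ _ F f) => [n|x _]; last exact: Ff.
  exact: integrableR_meas.
have f0 x : 0 <= f x.
  rewrite -(cvg_lim _ (Ff x))//; apply: limr_ge; first by apply/cvg_ex; exists (f x).
  exact: nearW.
split; last by rewrite /intR /Rintegral intf.
apply/integrableP; split; first exact/measurable_EFinP.
under eq_integral => x _ do rewrite /= (ger0_norm (f0 x)).
by rewrite intf ltry.
Qed.

End RealIntegral.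

(** * Cosine transforms with a phase *)

Section Kernels.
Context {R : realType}.
Local Notation mu := (@lebesgue_measure R).
Implicit Types (a b f g h : R -> R) (c s t x y z phi psi : R).

(** Fubini's theorem, applicable because the product of [c], [|a x|] and [|b y|] dominates the
    integrand. The first conclusion also supplies measurability of integrals depending on a
    parameter. *)
Lemma intR_kernel_swap a b (K : R -> R -> R) c :
  integrableR a -> integrableR b ->
  measurable_fun setT (fun xy : R * R => K xy.1 xy.2) ->
  (forall x y, `|K x y| <= c) ->
  integrableR (fun x => a x * intR (fun y => b y * K x y)) /\
  intR (fun x => a x * intR (fun y => b y * K x y)) =
  intR (fun y => b y * intR (fun x => a x * K x y)).
Proof.
move=> ai bi mK Kc.
have ma := integrableR_meas ai; have mb := integrableR_meas bi.
pose F (xy : R * R) : R := a xy.1 * (b xy.2 * K xy.1 xy.2).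
have mF : measurable_fun setT F.
  apply: measurable_funM; first exact: (measurableT_comp ma measurable_fst).
  by apply: measurable_funM => //; exact: (measurableT_comp mb measurable_snd).
have mFE : measurable_fun setT (EFin \o F) by apply/measurable_EFinP.
have mKx x : measurable_fun setT (K x).
  exact: (measurableT_comp mK (measurable_pair1 x)).
have mKy y : measurable_fun setT (K^~ y).
  exact: (measurableT_comp mK (measurable_pair2 y)).
have bKi x : integrableR (fun y => b y * K x y) by apply: integrableRM => //.
have aKi y : integrableR (fun x => a x * K x y).
  by apply: (integrableRM ai (mKy y)) => x; exact: Kc.
have Fi : (mu \x mu)%E.-integrable setT (EFin \o F).
  apply/(integrable12ltyP mu mu mFE).
  have bnd x : (\int[mu]_y `|(EFin \o F) (x, y)| <= (`|a x| * (c * intR (fun y => `|b y|)))%:E)%E.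
    have bci : integrableR (fun y => `|a x| * (c * `|b y|)).
      by apply: integrableRZ; apply: integrableRZ; exact: integrableR_norm.
    rewrite -[X in c * X]/(intR _) -intRZ; last exact: integrableR_norm.
    rewrite -intRZ; last by apply: integrableRZ; exact: integrableR_norm.
    rewrite -intRE//; apply: ge0_le_integral => //.
    - apply: measurableT_comp => //; apply/measurable_EFinP.
      exact: (measurableT_comp mF (measurable_pair1 x)).
    - by apply/measurable_EFinP; exact: integrableR_meas bci.
    - move=> y _; rewrite /= lee_fin /F /= !normrM ler_wpM2l//.
      by rewrite mulrC ler_wpM2r.
  apply: (@le_lt_trans _ _ (\int[mu]_x (`|a x| * (c * intR (fun y => `|b y|)))%:E)%E).
    apply: ge0_le_integral => //.
    - by move=> x _; exact: integral_ge0.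
    - have := @measurable_fun_fubini_tonelli_F _ _ _ _ R mu (fun xy => `|(EFin \o F) xy|%E).
      apply => //; exact: measurableT_comp.
    - apply/measurable_EFinP; apply: measurable_funM => //.
      exact: measurableT_comp.
  have abi : integrableR (fun x => `|a x| * (c * intR (fun y => `|b y|))).
    apply: eq_integrableR (integrableRZ (c * intR (fun y => `|b y|)) (integrableR_norm ai)) => x.
    by rewrite mulrC.
  by rewrite intRE// ltry.
have E1 x : fubini_F mu (EFin \o F) x = (a x * intR (fun y => b y * K x y))%:E.
  rewrite /fubini_F /= -intRZ// -intRE//; exact: integrableRZ.
have E2 : (\int[mu]_y \int[mu]_x (EFin \o F) (x, y) =
    \int[mu]_y (b y * intR (fun x => a x * K x y))%:E)%E.
  apply: eq_integral => y _; rewrite -intRZ// -intRE; last exact: integrableRZ.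
  by apply: eq_integral => x _; rewrite /= /F /=; congr (_%:E); ring.
have Gi : integrableR (fun x => a x * intR (fun y => b y * K x y)).
  have := integrable_fubini_F Fi; apply: eq_integrable => // x _; exact: E1.
split=> //.
rewrite /intR /Rintegral; congr fine; rewrite -E2.
rewrite -(Fubini Fi); apply: eq_integral => x _; exact: (esym (E1 x)).
Qed.

Definition cosT phi h y : R := intR (fun x => h x * cos (x * y + phi)).

Lemma measurable_cos_affine (y phi : R) :
  measurable_fun setT (fun x : R => cos (x * y + phi)).
Proof.
apply: (measurableT_comp (f := cos)).
  exact: (continuous_measurable_fun (@continuous_cos R)).
by apply: measurable_funD => //; exact: measurable_funM.
Qed.

Lemma integrable_cosT phi h y : integrableR h ->
  integrableR (fun x => h x * cos (x * y + phi)).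
Proof.
move=> hi; apply: (integrableRM hi (measurable_cos_affine y phi)) => x.
exact: cos_max.
Qed.

Lemma cosT_bound phi h y : integrableR h ->
  `|cosT phi h y| <= intR (fun x => `|h x|).
Proof.
move=> hi; apply: le_trans (le_norm_intR (integrable_cosT phi y hi)) _.
apply: le_intR; [exact/integrableR_norm/integrable_cosT|exact: integrableR_norm|].
by move=> x; rewrite normrM ler_piMr// cos_max.
Qed.

Lemma cosT_swap phi a b : integrableR a -> integrableR b ->
  intR (fun x => a x * cosT phi b x) = intR (fun x => b x * cosT phi a x).
Proof.
move=> ai bi; have [|_ <-] := intR_kernel_swap
  (K := fun x y => cos (x * y + phi)) ai bi _ (fun x y => cos_max _).
  apply: (measurableT_comp (f := cos)).
    exact: (continuous_measurable_fun (@continuous_cos R)).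
  by apply: measurable_funD => //; exact: measurable_funM.
apply: eq_intR => x; congr (_ * _); apply: eq_intR => y.
by rewrite [y * x]mulrC.
Qed.

(** Differentiation under the integral sign turns [cos] into [- sin], which is [cos] with the phase
    advanced by [pi / 2]. The phase parameter thus keeps all derivatives within the family
    [cosT]. *)
Lemma is_derive_cosT phi h y : integrableR h -> integrableR (fun x => x * h x) ->
  is_derive y 1 (cosT phi h) (cosT (phi + pi / 2) (fun x => x * h x) y).
Proof.
move=> hi xhi.
pose f y x := h x * cos (x * y + phi).
have df x z : is_derive z 1 (f^~ x) (x * h x * cos (x * z + (phi + pi / 2))).
  apply: is_derive_eq.
  by rewrite addrA cosDpihalf /GRing.scale /=; ring.
have yI : `]y - 1, y + 1[%classic y by rewrite /= in_itv/=; lra.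
have fi z : `]y - 1, y + 1[%classic z -> mu.-integrable setT (EFin \o f z).
  by move=> _; exact: integrable_cosT.
have fd z x : `]y - 1, y + 1[%classic z -> setT x -> derivable (f^~ x) z 1.
  by move=> _ _; have [] := df x z.
have G0 x : 0 <= `|x * h x| by [].
have Gi : mu.-integrable setT (EFin \o (fun x => `|x * h x|)).
  exact: integrableR_norm.
have Gub z x : `]y - 1, y + 1[%classic z -> setT x -> `|partial1of2 f z x| <= `|x * h x|.
  move=> _ _; rewrite partial1of2E; have [_ ->] := df x z.
  by rewrite normrM ler_piMr// cos_max.
apply: DeriveDef.
  exact: (derivable_under_integral measurableT yI fi fd G0 Gi Gub).
rewrite -derive1E.
have := differentiation_under_integral measurableT yI fi fd G0 Gi Gub.
rewrite -/(cosT phi h) => ->.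
apply: eq_Rintegral => x _; rewrite partial1of2E; have [_ ->] := df x y.
by [].
Qed.

End Kernels.

(** * Gaussians *)

Section Gaussians.
Context {R : realType}.
Local Notation mu := (@lebesgue_measure R).
Implicit Types (a b f g h : R -> R) (c s t x y z phi psi : R).

Definition gauss s x : R := expR (- (s * x ^+ 2)).

Lemma gauss_gt0 s x : 0 < gauss s x. Proof. exact: expR_gt0. Qed.

Lemma measurable_gauss s : measurable_fun setT (gauss s).
Proof.
apply: measurableT_comp => //; apply: measurableT_comp => //.
by apply: measurable_funM => //; exact: measurable_funX.
Qed.

Lemma gauss_le1 s x : 0 <= s -> gauss s x <= 1.
Proof. by move=> s0; rewrite -expR0 ler_expR oppr_le0 mulr_ge0 ?sqr_ge0. Qed.

Lemma intR_gauss_shift s c : 0 < s ->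
  integrableR (fun x => gauss s (x - c)) /\
  intR (fun x => gauss s (x - c)) = Num.sqrt (pi / s).
Proof.
(* The standard deviation of the normal density proportional to [gauss s]. *)
move=> s0; pose d : R := Num.sqrt (2 * s)^-1.
have d0 : d != 0 by rewrite gt_eqF// sqrtr_gt0 invr_gt0 mulr_gt0.
have d2 : d ^+ 2 *+ 2 = s^-1.
  rewrite sqr_sqrtr; last by rewrite invr_ge0 mulr_ge0// ltW.
  by rewrite -mulr_natl invfM mulrA divff// mul1r.
have peakE : normal_peak d = (Num.sqrt (pi / s))^-1.
  by rewrite /normal_peak -mulrnAl d2 mulrC.
have q0 : Num.sqrt (pi / s) != 0 :> R by rewrite gt_eqF// sqrtr_gt0 divr_gt0 ?pi_gt0.
have E x : Num.sqrt (pi / s) * normal_pdf c d x = gauss s (x - c).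
  rewrite normal_pdfE// peakE mulrA divff// mul1r /gauss /normal_fun d2 invrK.
  by rewrite mulNr mulrC.
have ni : integrableR (normal_pdf c d) := integrable_normal_pdf c d.
split; first by apply: eq_integrableR E _; exact: integrableRZ.
rewrite -(eq_intR E) intRZ// /intR /Rintegral integral_normal_pdf.
by rewrite /= mulr1.
Qed.

Lemma integrable_gauss s : 0 < s -> integrableR (gauss s).
Proof.
by move=> /(intR_gauss_shift 0) [+ _]; apply: eq_integrableR => x; rewrite subr0.
Qed.

Lemma intR_gauss s : 0 < s -> intR (gauss s) = Num.sqrt (pi / s).
Proof.
by move=> /(intR_gauss_shift 0) [_ <-]; apply: eq_intR => x; rewrite subr0.
Qed.

Lemma gaussD s t x : gauss (s + t) x = gauss s x * gauss t x.
Proof. by rewrite /gauss -expRD mulrDl opprD. Qed.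

(** Combines |x|^k <= 1 + x^(2(k+1)) with exp u >= 1 + u^(k+1) / (k+1)! at u = s x^2. *)
Lemma pow_gauss_bounded k s : 0 < s ->
  exists2 C, 0 <= C & forall x, `|x ^+ k * gauss s x| <= C.
Proof.
move=> s0; exists (1 + (k.+1)`!%:R * s^-1 ^+ k.+1).
  by rewrite addr_ge0// mulr_ge0// exprn_ge0// invr_ge0 ltW.
move=> x; rewrite normrM (gtr0_norm (gauss_gt0 _ _)) /gauss expRN.
rewrite ler_pdivrMr ?expR_gt0//.
have e1 : 1 <= expR (s * x ^+ 2).
  by rewrite -expR0 ler_expR mulr_ge0 ?sqr_ge0// ltW.
have xk : `|x ^+ k| <= 1 + (x ^+ 2) ^+ k.+1.
  have x0 := normr_ge0 x; rewrite normrX -(real_normK (num_real x)).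
  have [x1|x1] := leP `|x| 1.
    have xk1 : `|x| ^+ k <= 1 by exact: exprn_ile1.
    by rewrite (le_trans xk1)// lerDl exprn_ge0// sqr_ge0.
  rewrite -exprM; apply: (@le_trans _ _ (`|x| ^+ (2 * k.+1))); last by rewrite lerDr.
  by rewrite ler_eXn2l//; lia.
apply: le_trans xk _.
have := @expR_ge1Dxn R (s * x ^+ 2) k (mulr_ge0 (ltW s0) (sqr_ge0 x)).
set E := expR _; rewrite exprMn => H.
have sk : 0 < s ^+ k.+1 by rewrite exprn_gt0.
have f0 : 0 < (k.+1)`!%:R :> R by rewrite ltr0n fact_gt0.
rewrite mulrDl mul1r lerD// exprVn -mulrA mulrC -mulrA.
rewrite ler_pdivlMl// -ler_pdivrMr//; apply: le_trans H.
by rewrite lerDr.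
Qed.

(** Half of the exponent absorbs the power, the other half is integrable. *)
Lemma integrable_pow_gauss k s : 0 < s -> integrableR (fun x => x ^+ k * gauss s x).
Proof.
move=> s0; have s20 : 0 < s / 2 by rewrite divr_gt0.
have [C C0 HC] := pow_gauss_bounded k s20.
have mk : measurable_fun setT (fun x => x ^+ k * gauss (s / 2) x).
  by apply: measurable_funM; [exact: measurable_funX|exact: measurable_gauss].
apply: eq_integrableR (integrableRM (integrable_gauss s20) mk HC) => x.
by rewrite mulrCA -gaussD -splitr.
Qed.

Lemma is_derive_continuous F f : (forall x, is_derive x 1 F (f x)) -> continuous F.
Proof.
by move=> dF x; apply/differentiable_continuous/derivable1_diffP; have [] := dF x.
Qed.

Lemma intR_derive_vanishing F f :
  (forall x, is_derive x 1 F (f x)) -> continuous f -> integrableR f ->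
  F n%:R @[n --> \oo] --> 0 -> F (- n%:R) @[n --> \oo] --> 0 -> intR f = 0.
Proof.
move=> dF cf fi Fy FNy.
pose G n x := f x * \1_(`[- n%:R, n%:R] : set R) x.
have mf := integrableR_meas fi.
have [|||||_ cvg] := @intR_dominated _ G f (fun x => `|f x|).
- by move=> n; apply: measurable_funM => //; exact: measurable_indic.
- exact: mf.
- apply: aeW => x; apply: cvg_near_cst.
  near=> n; rewrite /G indicE mem_set ?mulr1//= in_itv/= -ler_norml.
  by near: n; exact: nbhs_infty_ger.
- exact: integrableR_norm.
- move=> n x; rewrite /G normrM ler_piMr// indicE.
  by case: (_ \in _); rewrite ?normr1 ?normr0.
(* The index is shifted because the fundamental theorem of calculus is applied on an interval of
   positive length. *)
have FE n : intR (G n.+1) = F n.+1%:R - F (- n.+1%:R).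
  have nn : - n.+1%:R < n.+1%:R :> R by have : 0 < n.+1%:R :> R by []; lra.
  rewrite /intR /Rintegral -[RHS]/(fine ((F n.+1%:R)%:E - (F (- n.+1%:R))%:E)%E).
  congr fine; rewrite -(@continuous_FTC2 R f F _ _ nn).
  - rewrite [RHS]integral_mkcond; apply: eq_integral => x _.
    by rewrite /G /= patchE indicE; case: ifP => _; rewrite ?mulr1 ?mulr0.
  - exact: continuous_subspaceT.
  - have dFc := is_derive_continuous dF.
    split; first by move=> x _; have [] := dF x.
    + apply: cvg_at_right_filter; exact: dFc.
    + apply: cvg_at_left_filter; exact: dFc.
  - by move=> x _; rewrite derive1E; have [_ ->] := dF x.
have cvgF : F n.+1%:R - F (- n.+1%:R) @[n --> \oo] --> 0 - 0.
  by apply: cvgB; [move: Fy|move: FNy]; rewrite -cvg_shiftS.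
have : intR (G n.+1) @[n --> \oo] --> 0.
  by under eq_fun do rewrite FE; rewrite subrr in cvgF.
move: cvg; rewrite -(cvg_shiftS (fun n => intR (G n))) => cvg cvg0.
exact: (cvg_unique _ cvg cvg0).
Unshelve. all: by end_near. Qed.

End Gaussians.

(** * Transform of a Gaussian *)

Section GaussianTransform.
Context {R : realType}.
Local Notation mu := (@lebesgue_measure R).
Implicit Types (a b f g h : R -> R) (c s t x y z phi psi : R).

(** The condition on [u] covers both [n] and [- n], the two ends at which a boundary term has to
    vanish. *)
Lemma gauss_vanishing s (u : nat -> R) (b : R -> R) : 0 < s ->
  (forall n, u n ^+ 2 = n%:R ^+ 2) -> (forall x, `|b x| <= 1) ->
  gauss s (u n) * b (u n) @[n --> \oo] --> 0.
Proof.
move=> s0 un b1; have [C C0 HC] := pow_gauss_bounded 1 s0.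
have bnd n : `|gauss s (u n) * b (u n)| <= (1 + C) * n.+1%:R^-1.
  rewrite normrM (gtr0_norm (gauss_gt0 _ _)) ler_pdivlMr// -[leRHS]mul1r.
  have gE : gauss s (u n) = gauss s n%:R by rewrite /gauss un.
  have g1 := gauss_le1 (n%:R) (ltW s0); have g0 := gauss_gt0 s (n%:R : R).
  have := HC n%:R; rewrite expr1 normrM (gtr0_norm g0) normr_nat gE => Cn.
  rewrite mulrAC mulrC ler_pM ?mulr_ge0 ?(ltW g0)//.
  by rewrite mulrC -natr1 mulrDl mul1r addrC lerD.
apply/cvgr0Pnorm_le => e e0.
have cv : (1 + C) * n.+1%:R^-1 @[n --> \oo] --> 0.
  by rewrite -[X in _ --> X](mulr0 (1 + C)); apply: cvgMr; exact: cvg_harmonic.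
move/cvgr0Pnorm_le : cv => /(_ e e0); apply: filterS => n; apply: le_trans.
by rewrite (le_trans (bnd n))// ler_norm.
Qed.

Lemma is_derive_gauss s x : is_derive x 1 (gauss s) (- (2 * s) * (x * gauss s x)).
Proof. by apply: is_derive_eq; rewrite /GRing.scale /= /gauss; ring. Qed.

Lemma continuous_gauss s : continuous (gauss s).
Proof. exact: is_derive_continuous (is_derive_gauss s). Qed.

Lemma continuous_cos_affine t phi : continuous (fun x : R => cos (x * t + phi)).
Proof.
move=> x; apply: (@continuous_comp _ _ _ (fun x : R => x * t + phi) cos).
  by apply: cvgD; [apply: cvgMl; exact: cvg_id|exact: cvg_cst].
exact: continuous_cos.
Qed.

(** Integration by parts: the combined integrand is the derivative of
    [gauss s x * sin (x * t + phi)]. Together with [is_derive_cosT] this reads T' = - t T / (2 s)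
    for the transform T of the Gaussian. *)
Lemma cosT_gauss_parts s t phi : 0 < s ->
  2 * s * cosT (phi + pi / 2) (fun x => x * gauss s x) t + t * cosT phi (gauss s) t = 0.
Proof.
move=> s0.
have gi := integrable_gauss s0.
have xgi : integrableR (fun x => x * gauss s x).
  by apply: eq_integrableR (integrable_pow_gauss 1 s0) => x; rewrite expr1.
have ti := integrable_cosT phi t gi; have xti := integrable_cosT (phi + pi / 2) t xgi.
rewrite /cosT -!intRZ// -intRD; [|exact: integrableRZ|exact: integrableRZ].
apply: (@intR_derive_vanishing _ (fun x => gauss s x * sin (x * t + phi))).
- move=> x; have dg := is_derive_gauss s x.
  apply: is_derive_eq; rewrite addrA cosDpihalf /GRing.scale /=; ring.
- move=> x; apply: cvgD; apply: cvgM; try exact: cvg_cst.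
    apply: cvgM; last exact: continuous_cos_affine.
    by apply: cvgM; [exact: cvg_id|exact: continuous_gauss].
  by apply: cvgM; [exact: continuous_gauss|exact: continuous_cos_affine].
- by apply: integrableRD; exact: integrableRZ.
- by apply: (gauss_vanishing (b := fun x => sin (x * t + phi))) => // x; exact: sin_max.
- apply: (gauss_vanishing (b := fun x => sin (x * t + phi))) => // [n|x].
    by rewrite sqrrN.
  exact: sin_max.
Qed.

(** Dividing by the expected Gaussian turns the differential equation of [cosT_gauss_parts] into a
    vanishing derivative; the constant is the value at 0. *)
Lemma cosT_gauss s t phi : 0 < s ->
  cosT phi (gauss s) t = cos phi * Num.sqrt (pi / s) * expR (- (t ^+ 2 / (4 * s))).
Proof.
move=> s0.
pose g y := cosT phi (gauss s) y * expR (y ^+ 2 / (4 * s)).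
have gi := integrable_gauss s0.
have xgi : integrableR (fun x => x * gauss s x).
  by apply: eq_integrableR (integrable_pow_gauss 1 s0) => x; rewrite expr1.
have dg y : is_derive y 1 g 0.
  have dc := is_derive_cosT phi y gi xgi.
  apply: is_derive_eq; rewrite /GRing.scale /=.
  have := cosT_gauss_parts y phi s0.
  set A := cosT _ _ _; set B := cosT _ _ _; set E := expR _ => H.
  have -> : A = - (y * B) / (2 * s).
    by apply: (canRL (mulfK _)); [rewrite gt_eqF// mulr_gt0|lra].
  by field; rewrite gt_eqF.
have := is_derive_0_is_cst t 0 dg; rewrite /g expr0n mul0r expR0 mulr1.
have -> : cosT phi (gauss s) 0 = cos phi * Num.sqrt (pi / s).
  rewrite -intR_gauss// -intRZ//; apply: eq_intR => x.
  by rewrite mulr0 add0r mulrC.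
by move=> <-; rewrite -mulrA -expRD subrr expR0 mulr1.
Qed.

End GaussianTransform.

(** * Plancherel's formula *)

Section Plancherel.
Context {R : realType}.
Local Notation mu := (@lebesgue_measure R).
Implicit Types (a b f g h : R -> R) (c e s t x y z phi psi : R).

Lemma measurable_cosT phi h : integrableR h -> measurable_fun setT (cosT phi h).
Proof.
move=> hi.
have mK : measurable_fun setT (fun xy : R * R => cos (xy.1 * xy.2 + phi)).
  apply: (measurableT_comp (f := cos)).
    exact: (continuous_measurable_fun (@continuous_cos R)).
  by apply: measurable_funD => //; exact: measurable_funM.
(* Measurability is read off from the integrability of the product with a Gaussian weight, which is
   then divided out. *)
have [gi _] := intR_kernel_swap (K := fun x y => cos (x * y + phi))
  (integrable_gauss (@ltr01 R)) hi mK (fun x y => cos_max _).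
have me : measurable_fun setT (fun y : R => expR (1 * y ^+ 2)).
  apply: measurableT_comp => //; apply: measurable_funM => //; exact: measurable_funX.
rewrite (_ : cosT phi h =
  fun y => expR (1 * y ^+ 2) * (gauss 1 y * intR (fun x => h x * cos (y * x + phi)))).
  by apply: measurable_funM => //; exact: integrableR_meas gi.
apply/funext => y; rewrite mulrA /gauss -expRD subrr expR0 mul1r.
by apply: eq_intR => x; rewrite [y * x]mulrC.
Qed.

(** This is [pi] times the Gauss-Weierstrass kernel at time [e]. *)
Definition heat_kernel e x : R := Num.sqrt (pi / e) / 2 * gauss (4 * e)^-1 x.

Lemma heat_kernel_ge0 e x : 0 <= heat_kernel e x.
Proof. by rewrite mulr_ge0 ?divr_ge0 ?sqrtr_ge0// ltW// gauss_gt0. Qed.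

Lemma integrable_heat_kernel e z : 0 < e -> integrableR (fun x => heat_kernel e (x - z)).
Proof.
move=> e0; apply: integrableRZ.
by have [] := @intR_gauss_shift _ (4 * e)^-1 z _; rewrite ?invr_gt0 ?mulr_gt0.
Qed.

Lemma intR_heat_kernel e z : 0 < e -> intR (fun x => heat_kernel e (x - z)) = pi.
Proof.
move=> e0; have [gi gE] := @intR_gauss_shift _ (4 * e)^-1 z (ltac:(by rewrite invr_gt0 mulr_gt0)).
rewrite intRZ// gE invrK.
have -> : pi * (4 * e) = 2 ^+ 2 * (pi * e) :> R by ring.
have p0 := pi_gt0 R.
rewrite [Num.sqrt (2 ^+ 2 * _)]sqrtrM ?sqr_ge0// sqrtr_sqr ger0_norm// !mulrA mulfVK//.
rewrite -sqrtrM ?divr_ge0 ?ltW//.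
rewrite (_ : pi / e * (pi * e) = pi ^+ 2); last by field; rewrite gt_eqF.
by rewrite sqrtr_sqr ger0_norm// ltW.
Qed.

(** Half of the exponent is traded for the factor [e / d ^+ 2] through exp u >= 1 + u; the other
    half remains as the kernel at time [2 * e], whose integral over the whole line is known. *)
Lemma heat_kernel_tail e d x : 0 < e -> 0 < d -> d <= `|x| ->
  heat_kernel e x <= 16 * e / d ^+ 2 * heat_kernel (2 * e) x.
Proof.
move=> e0 d0 dx; have p0 := pi_gt0 R.
rewrite /heat_kernel.
have sE : Num.sqrt (pi / e) <= 2 * Num.sqrt (pi / (2 * e)).
  rewrite -[leRHS](_ : Num.sqrt (2 ^+ 2 * (pi / (2 * e))) = _); last first.
    by rewrite sqrtrM ?sqr_ge0// sqrtr_sqr ger0_norm.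
  apply: ler_wsqrtr.
  rewrite (_ : 2 ^+ 2 * (pi / (2 * e)) = 2 * (pi / e)); last by field; rewrite gt_eqF.
  by rewrite ler_peMl// ?divr_ge0 ?ltW//; lra.
have gE : gauss (4 * e)^-1 x <= 8 * e / d ^+ 2 * gauss (4 * (2 * e))^-1 x.
  rewrite (_ : (4 * e)^-1 = (8 * e)^-1 + (4 * (2 * e))^-1); last by field; rewrite gt_eqF.
  rewrite gaussD ler_wpM2r ?(ltW (gauss_gt0 _ _))//.
  rewrite /gauss expRN -[leRHS]invrK lef_pV2 ?posrE ?expR_gt0//; last first.
    by rewrite invr_gt0 divr_gt0 ?mulr_gt0 ?exprn_gt0.
  apply: le_trans (expR_ge1Dx _).
  have -> : (8 * e / d ^+ 2)^-1 = (8 * e)^-1 * d ^+ 2 by rewrite invf_div mulrC.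
  rewrite -(real_normK (num_real x)).
  have : (8 * e)^-1 * d ^+ 2 <= (8 * e)^-1 * `|x| ^+ 2.
    by rewrite ler_wpM2l ?invr_ge0 ?mulr_ge0 ?(ltW e0)// lerXn2r ?nnegrE// ltW.
  lra.
have := ler_pM (sqrtr_ge0 _) (ltW (gauss_gt0 _ _)) sE gE.
lra.
Qed.

Lemma heat_kernel_approx_id h x (M : R) : integrableR h -> (forall x, `|h x| <= M) ->
  {for x, continuous h} ->
  intR (fun z => h z * heat_kernel n.+1%:R^-1 (z - x)) @[n --> \oo] --> pi * h x.
Proof.
move=> hi hM hx; have p0 := pi_gt0 R; have M0 : 0 <= M by rewrite (le_trans _ (hM 0)).
apply/cvgrPdist_le => r r0.
have r2 : 0 < r / (2 * pi) by rewrite divr_gt0 ?mulr_gt0.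
have /cvgrPdist_le/(_ _ r2)[d /= d0 Hd] := hx.
have mK e : measurable_fun setT (fun z => heat_kernel e (z - x)).
  apply: measurable_funM => //; apply: (measurableT_comp (measurable_gauss _)).
  exact: measurable_funB.
(* The majorant is a sum of two full kernels, one for [z] close to [x] and one for the other [z], so
   the integral itself is never split. *)
have key e : 0 < e ->
    `|pi * h x - intR (fun z => h z * heat_kernel e (z - x))| <=
    r / 2 + (2 * M * 16 * pi / d ^+ 2) * e.
  move=> e0; have e20 : 0 < 2 * e by rewrite mulr_gt0.
  have Ki := integrable_heat_kernel x e0; have K2i := integrable_heat_kernel x e20.
  have hKi : integrableR (fun z => h z * heat_kernel e (z - x)).
    apply: eq_integrableR (integrableRM Ki (integrableR_meas hi) hM) => z.
    by rewrite mulrC.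
  have -> : pi * h x = intR (fun z => h x * heat_kernel e (z - x)).
    by rewrite (intRZ _ Ki) intR_heat_kernel// mulrC.
  rewrite -intRB//; last exact: integrableRZ.
  have iB := integrableRB (integrableRZ (h x) Ki) hKi.
  apply: le_trans (le_norm_intR iB) _.
  have -> : r / 2 + 2 * M * 16 * pi / d ^+ 2 * e =
    intR (fun z => r / (2 * pi) * heat_kernel e (z - x) +
      2 * M * (16 * e / d ^+ 2) * heat_kernel (2 * e) (z - x)).
    rewrite intRD; [|exact: integrableRZ|exact: integrableRZ].
    rewrite (intRZ _ Ki) (intRZ _ K2i) !intR_heat_kernel//.
    move: (pi : R) p0 => q q0; field; by rewrite !gt_eqF.
  apply: le_intR; [exact: integrableR_norm|by apply: integrableRD; exact: integrableRZ|].
  move=> z; rewrite -mulrBl normrM (ger0_norm (heat_kernel_ge0 _ _)).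
  have K0 := heat_kernel_ge0 e (z - x); have K20 := heat_kernel_ge0 (2 * e) (z - x).
  have [zd|zd] := ltP `|z - x| d.
    have hz : `|h x - h z| <= r / (2 * pi) by apply: Hd; rewrite /= distrC.
    rewrite (le_trans (ler_wpM2r K0 hz))// lerDl; apply: mulr_ge0 => //.
    apply: mulr_ge0; first exact: mulr_ge0.
    by apply: divr_ge0; [apply: mulr_ge0 => //; exact: ltW|exact: sqr_ge0].
  have hz : `|h x - h z| <= 2 * M.
    by rewrite (le_trans (ler_normB _ _))// mulr2n mulrDl mul1r lerD.
  have tl := heat_kernel_tail e0 d0 zd.
  apply: le_trans (ler_pM (normr_ge0 _) K0 hz tl) _.
  by rewrite [leLHS]mulrA lerDr; apply: mulr_ge0 => //; exact: ltW.
have cv : (2 * M * 16 * pi / d ^+ 2) * n.+1%:R^-1 @[n --> \oo] --> 0.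
  rewrite -[X in _ --> X](mulr0 (2 * M * 16 * pi / d ^+ 2)).
  by apply: cvgMr; exact: cvg_harmonic.
have r20 : 0 < r / 2 by rewrite divr_gt0.
move/cvgr0Pnorm_le : cv => /(_ _ r20); apply: filterS => n Hn.
have n0 : 0 < n.+1%:R^-1 :> R by rewrite invr_gt0.
apply: le_trans (key _ n0) _.
by rewrite [leRHS]splitr lerD2l (le_trans (ler_norm _)).
Qed.

(** The product of cosines is half of [cos (y * (z - x))] plus half of
    [cos (y * (z + x) + 2 * phi)]. The transform of a Gaussian carries the cosine of its phase as a
    factor, so the condition on [phi] removes the second part. *)
Lemma cosT_gauss_cos e phi x z : 0 < e -> cos (2 * phi) = 0 ->
  cosT phi (fun y => gauss e y * cos (y * x + phi)) z = heat_kernel e (z - x).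
Proof.
move=> e0 phi0; have gi := integrable_gauss e0.
have -> : heat_kernel e (z - x) =
    2^-1 * (cosT 0 (gauss e) (z - x) + cosT (2 * phi) (gauss e) (z + x)).
  rewrite !cosT_gauss// phi0 cos0 /heat_kernel /gauss !mul0r addr0 mul1r.
  by rewrite [_^-1 * _ ^+ 2]mulrC mulrA [_^-1 * _]mulrC.
rewrite -intRD; [|exact: integrable_cosT|exact: integrable_cosT].
rewrite -intRZ; last by apply: integrableRD; exact: integrable_cosT.
apply: eq_intR => y.
have -> : y * (z - x) + 0 = (y * z + phi) - (y * x + phi) by ring.
have -> : y * (z + x) + 2 * phi = (y * z + phi) + (y * x + phi) by ring.
move: (y * z + phi) (y * x + phi) => u v; by rewrite cosB cosD; field.
Qed.

(** Plancherel's formula with a Gaussian cut-off in frequency: [cosT_swap] moves the two transforms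
    one after the other. *)
Lemma intR_cosT_sqr_gauss e phi h : 0 < e -> cos (2 * phi) = 0 -> integrableR h ->
  integrableR (fun y => gauss e y * cosT phi h y ^+ 2) /\
  intR (fun y => gauss e y * cosT phi h y ^+ 2) =
  intR (fun x => h x * intR (fun z => h z * heat_kernel e (z - x))).
Proof.
move=> e0 phi0 hi; have gi := integrable_gauss e0.
have mT := measurable_cosT phi hi.
have ai : integrableR (fun y => gauss e y * cosT phi h y).
  by apply: (integrableRM gi mT) => y; exact: cosT_bound.
have E y : gauss e y * cosT phi h y ^+ 2 = gauss e y * cosT phi h y * cosT phi h y.
  by rewrite expr2 mulrA.
split.
  apply: eq_integrableR (integrableRM ai mT (fun y => cosT_bound phi y hi)) => y.
  by rewrite E.
rewrite (eq_intR E) cosT_swap//; apply: eq_intR => x; congr (_ * _).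
rewrite -[LHS]/(intR _).
under eq_intR do rewrite mulrAC.
rewrite cosT_swap//; last exact: integrable_cosT.
by apply: eq_intR => z; rewrite cosT_gauss_cos.
Qed.

(* The hypothesis on [phi] makes [cosT phi] a multiple of a Hartley transform,
   which is unitary on real functions. *)
Lemma cosT_plancherel phi h (M : R) : cos (2 * phi) = 0 -> integrableR h ->
  (forall x, `|h x| <= M) -> {ae mu, forall x, {for x, continuous h}} ->
  integrableR (fun y => cosT phi h y ^+ 2) /\
  intR (fun y => cosT phi h y ^+ 2) = pi * intR (fun x => h x ^+ 2).
Proof.
move=> phi0 hi hM hc; have p0 := pi_gt0 R; have M0 : 0 <= M by rewrite (le_trans _ (hM 0)).
have mh := integrableR_meas hi.
pose e n : R := n.+1%:R^-1.
have e0 n : 0 < e n by rewrite invr_gt0.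
have h2i : integrableR (fun x => h x ^+ 2).
  by apply: eq_integrableR (integrableRM hi mh hM) => x; rewrite expr2.
(* As the cut-off is removed, the frequency side increases to its limit, while the other side
   converges by dominated convergence. *)
apply: (@intR_monotone _ (fun n y => gauss (e n) y * cosT phi h y ^+ 2)).
- by move=> n; have [] := intR_cosT_sqr_gauss (e0 n) phi0 hi.
- by move=> n y; rewrite mulr_ge0 ?sqr_ge0 ?ltW ?gauss_gt0.
- move=> y n m nm; rewrite ler_wpM2r ?sqr_ge0// ler_expR lerN2 ler_wpM2r ?sqr_ge0//.
  by rewrite lef_pV2 ?posrE// ler_nat.
- move=> y; rewrite -[X in _ --> X]mul1r; apply: cvgMl.
  have : - (e n * y ^+ 2) @[n --> \oo] --> 0.
    by rewrite -oppr0; apply: cvgN; rewrite -(mul0r (y ^+ 2)); apply: cvgMl; exact: cvg_harmonic.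
  move=> c0; rewrite -expR0; exact: (continuous_cvg (h := expR) _ (@continuous_expR R 0) c0).
- rewrite -intRZ//.
  have E n : intR (fun y => gauss (e n) y * cosT phi h y ^+ 2) =
    intR (fun x => h x * intR (fun z => h z * heat_kernel (e n) (z - x))).
    by have [] := intR_cosT_sqr_gauss (e0 n) phi0 hi.
  under eq_fun do rewrite E.
  have mK n : measurable_fun setT (fun xy : R * R => heat_kernel (e n) (xy.2 - xy.1)).
    apply: measurable_funM => //; apply: (measurableT_comp (measurable_gauss _)).
    exact: measurable_funB.
  have Kb n (x y : R) : `|heat_kernel (e n) (y - x)| <= Num.sqrt (pi / e n) / 2.
    rewrite ger0_norm ?heat_kernel_ge0// ler_piMr ?divr_ge0 ?sqrtr_ge0//.
    by rewrite gauss_le1// invr_ge0 mulr_ge0// ltW.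
  have [|||||] := @intR_dominated _
    (fun n x => h x * intR (fun z => h z * heat_kernel (e n) (z - x)))
    (fun x => pi * h x ^+ 2) (fun x => M * pi * `|h x|).
  + move=> n; have [ii _] := intR_kernel_swap
      (K := fun x z => heat_kernel (e n) (z - x)) hi hi (mK n) (Kb n).
    exact: integrableR_meas ii.
  + exact: integrableR_meas (integrableRZ pi h2i).
  + move: hc; apply: filterS; first exact: (ae_filter_ringOfSetsType mu).
    move=> x hx; rewrite expr2 mulrCA; apply: cvgMr; exact: (heat_kernel_approx_id hi hM hx).
  + by apply: integrableRZ; exact: integrableR_norm.
  + move=> n x; rewrite normrM mulrC ler_wpM2r//.
    have Ki := integrable_heat_kernel x (e0 n).
    have hKi : integrableR (fun z => h z * heat_kernel (e n) (z - x)).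
      by apply: eq_integrableR (integrableRM Ki mh hM) => z; rewrite mulrC.
    rewrite (le_trans (le_norm_intR hKi))// -(intR_heat_kernel x (e0 n)) -intRZ//.
    apply: le_intR; [exact: integrableR_norm|exact: integrableRZ|].
    by move=> z; rewrite normrM (ger0_norm (heat_kernel_ge0 _ _)) ler_wpM2r// heat_kernel_ge0.
  by [].
Qed.

End Plancherel.

(** * Sums over dyadic scales *)

Section ScaleSums.
Context {R : realType}.
Implicit Types (r s t x y : R) (m l : nat).

(* [symbol_term m l t] is the squared modulus of the Fourier transform of [G_l] at a
   frequency [w] with [w^2 = 16 t]. *)
Definition symbol_term m l t : R :=
  'C(m, l)%:R * t ^+ l * expR (- (2 / 3 * (2 * m%:R - l%:R) * t)).

Definition symbol_base t : R := expR (- (4 / 3 * t)) + t * expR (- (2 / 3 * t)).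

(** Binomial expansion of [symbol_base t ^+ m]: the exponents match because (4/3)(m - l) + (2/3) l =
    (2/3)(2m - l). The subtracted power is the term l = 0, for which there is no generator. *)
Lemma symbol_sum m t : \sum_(i < m) symbol_term m i.+1 t =
  symbol_base t ^+ m - expR (- (4 / 3 * t)) ^+ m.
Proof.
rewrite /symbol_base exprDn big_ord_recl /= subn0 expr0 mulr1 bin0 mulr1n addrAC subrr add0r.
apply: eq_bigr => i _; rewrite /bump leq0n add1n /symbol_term -[RHS]mulr_natl -mulrA.
congr (_ * _); rewrite exprMn mulrCA; congr (_ * _).
rewrite -!expRM_natl -expRD; congr expR.
by rewrite natrB//; field.
Qed.

Lemma symbol_base_le t : 0 <= t -> symbol_base t <= expR (- (t / 6)).
Proof.
(* The base is r^8 + t r^4 and t r <= 6 (1 - r), so it suffices that r (1 - r) (1 + r + ... + r^6 -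
   6 r^2) be nonnegative. The squares in [e2] and [e3] are centred near the minimum of the last
   factor. *)
move=> t0; set r := expR (- (t / 6)).
have r0 : 0 < r by exact: expR_gt0.
have r1 : r <= 1 by rewrite -[leRHS]expR0 ler_expR; lra.
have tr : t * r <= 6 * (1 - r).
  have := expR_ge1Dx (t / 6); rewrite -[X in expR X]opprK expRN -/r.
  rewrite -(ler_pM2r r0) mulVf ?gt_eqF//; lra.
rewrite /symbol_base (_ : - (4 / 3 * t) = 8 * - (t / 6)); last by lra.
rewrite (_ : - (2 / 3 * t) = 4 * - (t / 6)); last by lra.
rewrite !expRM_natl -/r.
have e1 : t * r ^+ 4 <= 6 * (1 - r) * r ^+ 3.
  by rewrite exprS mulrA ler_wpM2r// exprn_ge0// ltW.
have e2 : 0 <= r * (r - 3 / 4) ^+ 2 * (r ^+ 3 + r ^+ 2 + r + 1 + 3 / 2 * (r ^+ 2 + r + 1)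
    + 27 / 16 * (r + 1) + 27 / 16).
  have ? : 0 <= r by exact: ltW.
  have ? : 0 <= r ^+ 3 by exact: exprn_ge0.
  have ? := sqr_ge0 r.
  apply: mulr_ge0; first by apply: mulr_ge0; [|exact: sqr_ge0].
  lra.
have e3 : 0 <= r ^+ 6 + r ^+ 5 + r ^+ 4 + r ^+ 3 - 5 * r ^+ 2 + r + 1.
  by have := sqr_ge0 (r - 4 / 5); have := sqr_ge0 r; lra.
have : 0 <= r * (1 - r) * (r ^+ 6 + r ^+ 5 + r ^+ 4 + r ^+ 3 - 5 * r ^+ 2 + r + 1).
  by apply: mulr_ge0 => //; apply: mulr_ge0; [exact: ltW|lra].
lra.
Qed.

(** Factoring out [expR (- (t / 3))] leaves e^(-t) + t e^(-t/3) - 1, in which the terms of order 0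
    and 1 cancel. *)
Lemma symbol_base_approx t : 0 <= t -> `|symbol_base t - expR (- (t / 3))| <= t ^+ 2.
Proof.
move=> t0; have -> : symbol_base t - expR (- (t / 3)) =
    expR (- (t / 3)) * (expR (- t) + t * expR (- (t / 3)) - 1).
  rewrite /symbol_base.
  have -> : expR (- (4 / 3 * t)) = expR (- (t / 3)) * expR (- t).
    by rewrite -expRD; congr expR; lra.
  have -> : expR (- (2 / 3 * t)) = expR (- (t / 3)) * expR (- (t / 3)).
    by rewrite -expRD; congr expR; lra.
  ring.
have q0 := expR_gt0 (- (t / 3)); have q1 : expR (- (t / 3)) <= 1.
  by rewrite -[leRHS]expR0 ler_expR; lra.
have q2 := expR_ge1Dx (- (t / 3)).
have p1 := expR_ge1Dx (- t).
have p2 : expR (- t) <= 1 - t + t ^+ 2.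
  rewrite expRN -[leRHS]invrK lef_pV2 ?posrE ?expR_gt0 ?invr_gt0//; last by nra.
  apply: le_trans (expR_ge1Dx t); rewrite -[leLHS]mul1r ler_pdivrMr; nra.
rewrite normrM gtr0_norm//.
have : `|expR (- t) + t * expR (- (t / 3)) - 1| <= t ^+ 2 by rewrite ler_norml; nra.
have := normr_ge0 (expR (- t) + t * expR (- (t / 3)) - 1).
set X := `|_|; nra.
Qed.

Lemma ler_norm_subXX m x y r : 0 <= x <= r -> 0 <= y <= r ->
  `|x ^+ m - y ^+ m| <= m%:R * `|x - y| * r ^+ m.-1.
Proof.
move=> /andP[x0 xr] /andP[y0 yr].
rewrite subrXX normrM [m%:R * _]mulrC -mulrA ler_wpM2l//.
have H : `|\sum_(i < m) x ^+ (m.-1 - i) * y ^+ i| <= \sum_(i < m) r ^+ m.-1.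
  apply: le_trans (ler_norm_sum _ _ _) _; apply: ler_sum => i _.
  rewrite ger0_norm ?mulr_ge0 ?exprn_ge0//.
  have im : (i <= m.-1)%N by case: m i => [[]|m i] //; rewrite -ltnS.
  rewrite -[in leRHS](subnK im) exprD ler_pM ?exprn_ge0// lerXn2r ?nnegrE//.
    exact: le_trans xr.
  exact: le_trans yr.
by apply: le_trans H _; rewrite sumr_const card_ord mulr_natl.
Qed.

(* Turns the error terms into differences that telescope over dyadic scales. *)
Lemma sqr_expR_le x : 0 <= x -> x ^+ 2 * expR (- x) <= 4 * (expR (- (x / 4)) - expR (- x)).
Proof.
move=> x0; have -> : expR (- (x / 4)) = expR (3 * x / 4) * expR (- x).
  by rewrite -expRD; congr expR; field.
rewrite (_ : 4 * _ = 4 * (expR (3 * x / 4) - 1) * expR (- x)); last by ring.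
rewrite ler_wpM2r ?expR_ge0//.
have := @expR_ge1Dxn _ (3 * x / 4) 1 (ltac:(lra)).
rewrite (_ : (2`!%:R : R) = 2)//; nra.
Qed.

(** The constants come from [sqr_expR_le] at x = (m - 1) t / 6: 144 is its factor 4 times the 36 in
    t^2 = 36 x^2 / (m - 1)^2. For this x, [scale_tail m t] is e^(-x/4) and [scale_tail m (4 * t)] is
    e^(-x). *)
Definition scale_error m : R := 144 * m%:R / m.-1%:R ^+ 2.

Definition scale_tail m t : R := expR (- (m.-1%:R / 24 * t)).

Definition scale_main m t : R := expR (- (m%:R / 3 * t)).

Lemma sqr_scale_le m t : (2 <= m)%N -> 0 <= t ->
  m%:R * t ^+ 2 * expR (- (t / 6)) ^+ m.-1 <=
  scale_error m * (scale_tail m t - scale_tail m (4 * t)).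
Proof.
move=> m2 t0; have p0 : 0 < m.-1%:R :> R by rewrite ltr0n; lia.
have := sqr_expR_le (mulr_ge0 (ltW p0) (divr_ge0 t0 (ltac:(lra) : 0 <= 6 :> R))).
rewrite -expRM_natl mulrN.
rewrite /scale_tail.
rewrite (_ : m.-1%:R * (t / 6) / 4 = m.-1%:R / 24 * t); last by field.
rewrite (_ : m.-1%:R / 24 * (4 * t) = m.-1%:R * (t / 6)); last by field.
move=> H; rewrite /scale_error.
have c0 : 0 <= 36 * m%:R / m.-1%:R ^+ 2 :> R by rewrite divr_ge0 ?mulr_ge0 ?sqr_ge0.
have := ler_wpM2l c0 H; set E := expR _; set E' := expR _.
congr (_ <= _); field; exact: lt0r_neq0.
Qed.

Definition symbol m t : R := \sum_(i < m) symbol_term m i.+1 t.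

Lemma symbol_term_ge0 m l t : 0 <= t -> 0 <= symbol_term m l t.
Proof. by move=> t0; rewrite !mulr_ge0 ?exprn_ge0 ?expR_ge0. Qed.

Lemma symbol_approx m t : (2 <= m)%N -> 0 <= t ->
  `|symbol m t - (scale_main m t - scale_main m (4 * t))| <=
  scale_error m * (scale_tail m t - scale_tail m (4 * t)).
Proof.
move=> m2 t0; apply: le_trans (sqr_scale_le m2 t0).
have -> : symbol m t - (scale_main m t - scale_main m (4 * t)) =
    symbol_base t ^+ m - expR (- (t / 3)) ^+ m.
  rewrite /symbol symbol_sum /scale_main -!expRM_natl.
  rewrite (_ : m%:R * - (4 / 3 * t) = - (m%:R / 3 * (4 * t))); last by field.
  rewrite (_ : m%:R * - (t / 3) = - (m%:R / 3 * t)); last by field.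
  by lra.
have b0 : 0 <= symbol_base t by rewrite addr_ge0 ?mulr_ge0 ?expR_ge0.
apply: le_trans (@ler_norm_subXX _ _ _ (expR (- (t / 6))) _ _) _.
- by rewrite b0 symbol_base_le.
- by rewrite expR_ge0 ler_expR; lra.
by rewrite ler_wpM2r ?exprn_ge0 ?expR_ge0// ler_wpM2l// symbol_base_approx.
Qed.

(** [symbol m t] is a difference of m-th powers of bases at distance at most t, hence at most m t
    r^(m-1) with r = e^(-t/6). The extra factor t leads to the same majorant as in
    [symbol_approx]. *)
Lemma mul_symbol_le m t : (2 <= m)%N -> 0 <= t ->
  t * symbol m t <= scale_error m * (scale_tail m t - scale_tail m (4 * t)).
Proof.
move=> m2 t0; apply: le_trans (sqr_scale_le m2 t0).
have b0 : 0 <= symbol_base t by rewrite addr_ge0 ?mulr_ge0 ?expR_ge0.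
have := @ler_norm_subXX m (symbol_base t) (expR (- (4 / 3 * t))) (expR (- (t / 6))).
rewrite b0 symbol_base_le// expR_ge0 ler_expR => /(_ isT (ltac:(lra))).
rewrite /symbol symbol_sum => H.
have sb : `|symbol_base t - expR (- (4 / 3 * t))| <= t.
  rewrite /symbol_base addrC addKr normrM !ger0_norm ?expR_ge0// ler_piMr//.
  by rewrite -[leRHS]expR0 ler_expR; lra.
rewrite (_ : m%:R * t ^+ 2 * _ = t * (m%:R * t * expR (- (t / 6)) ^+ m.-1)); last by ring.
rewrite ler_wpM2l//; apply: le_trans (ler_norm _) _; apply: le_trans H _.
by rewrite ler_wpM2r ?exprn_ge0 ?expR_ge0// ler_wpM2l.
Qed.

Lemma scale_error_ge0 m : 0 <= scale_error m.
Proof. by rewrite divr_ge0 ?mulr_ge0 ?exprn_ge0. Qed.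

Lemma scale_tail_telescope m n s : 0 <= s ->
  \sum_(i < n) (scale_tail m (4 ^+ i * s) - scale_tail m (4 * (4 ^+ i * s))) <= 1.
Proof.
move=> s0; have -> : \sum_(i < n) (scale_tail m (4 ^+ i * s) -
    scale_tail m (4 * (4 ^+ i * s))) = scale_tail m s - scale_tail m (4 ^+ n * s).
  elim: n => [|n IH]; first by rewrite big_ord0 expr0 mul1r subrr.
  by rewrite big_ord_recr /= IH exprS mulrA; lra.
have : scale_tail m s <= 1.
  by rewrite -[leRHS]expR0 ler_expR oppr_le0 !mulr_ge0.
have := expR_gt0 (- (m.-1%:R / 24 * (4 ^+ n * s))); rewrite -/(scale_tail _ _); lra.
Qed.

Lemma symbol_telescope m n s : (2 <= m)%N -> 0 <= s ->
  `|\sum_(i < n) symbol m (4 ^+ i * s) - (scale_main m s - scale_main m (4 ^+ n * s))|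
    <= scale_error m.
Proof.
move=> m2 s0; have -> : scale_main m s - scale_main m (4 ^+ n * s) =
   \sum_(i < n) (scale_main m (4 ^+ i * s) - scale_main m (4 * (4 ^+ i * s))).
  elim: n => [|n IH]; first by rewrite big_ord0 expr0 mul1r subrr.
  by rewrite big_ord_recr /= -IH exprS mulrA; lra.
rewrite -sumrB; apply: le_trans (ler_norm_sum _ _ _) _.
apply: (@le_trans _ _ (\sum_(i < n) scale_error m *
    (scale_tail m (4 ^+ i * s) - scale_tail m (4 * (4 ^+ i * s))))).
  by apply: ler_sum => i _; apply: symbol_approx => //; rewrite mulr_ge0// exprn_ge0.
by rewrite -mulr_sumr ler_piMr ?scale_error_ge0// scale_tail_telescope.
Qed.

Lemma mul_symbol_sum_le m n s : (2 <= m)%N -> 0 <= s ->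
  \sum_(i < n) (4 ^+ i * s) * symbol m (4 ^+ i * s) <= scale_error m.
Proof.
move=> m2 s0; apply: (@le_trans _ _ (\sum_(i < n) scale_error m *
    (scale_tail m (4 ^+ i * s) - scale_tail m (4 * (4 ^+ i * s))))).
  by apply: ler_sum => i _; apply: mul_symbol_le => //; rewrite mulr_ge0// exprn_ge0.
by rewrite -mulr_sumr ler_piMr ?scale_error_ge0// scale_tail_telescope.
Qed.

Lemma scale_error_bounded : exists2 C : R, 0 <= C &
  forall m, (2 <= m)%N -> scale_error m * m%:R <= C.
Proof.
exists (144 * 4) => [|m m2]; first by rewrite mulr_ge0.
rewrite /scale_error.
have p0 : 0 < m.-1%:R :> R by rewrite ltr0n; lia.
have m0 : 0 < m%:R :> R by rewrite ltr0n; lia.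
rewrite mulrAC ler_pdivrMr ?exprn_gt0// -!mulrA ler_wpM2l//.
have H : m%:R <= 2 * m.-1%:R :> R by rewrite -natrM ler_nat; lia.
by have := ler_pM (ltW m0) (ltW m0) H H; lra.
Qed.

End ScaleSums.

(** * Riemann sums of squares *)

Section Sampling.
Context {R : realType}.
Local Notation mu := (@lebesgue_measure R).
Implicit Types (F G f g : R -> R) (a b c d e x y : R).

(** Half-open intervals concatenate without overlap, and the indicator keeps all integrals on the
    whole line, where the lemmas on [intR] apply. *)
Definition int_itv a b g : R := intR (fun x => g x * \1_(`[a, b[ : set R) x).

Lemma integrable_itv a b g : integrableR g ->
  integrableR (fun x => g x * \1_(`[a, b[ : set R) x).
Proof.
move=> gi; apply: (@integrableRM _ _ _ 1) => //.

by move=> x; rewrite indicE; case: (_ \in _); rewrite ?normr1 ?normr0.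
Qed.

Lemma int_itv_cat a b c g : a <= b -> b <= c -> integrableR g ->
  int_itv a c g = int_itv a b g + int_itv b c g.
Proof.
move=> ab bc gi; rewrite -intRD; [|exact: integrable_itv|exact: integrable_itv].
apply: eq_intR => x; rewrite -mulrDr; congr (_ * _).
rewrite !indicE !mem_setE !in_itv/=.
case: (leP a x) => ax /=; case: (ltP x b) => xb /=; case: (leP b x) => bx /=;
  case: (ltP x c) => xc /=; rewrite ?addr0 ?add0r //; lra.
Qed.

Lemma le_int_itv a b f g : integrableR f -> integrableR g ->
  (forall x, a <= x < b -> f x <= g x) -> int_itv a b f <= int_itv a b g.
Proof.
move=> fi gi fg; apply: le_intR; [exact: integrable_itv|exact: integrable_itv|].
move=> x; rewrite indicE mem_setE in_itv/=; case: (boolP (a <= x < b)) => [/fg|_]; rewrite ?mulr1//.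
by rewrite !mulr0.
Qed.

Lemma int_itv_derive a b F f : a < b -> (forall x, is_derive x 1 F (f x)) ->
  continuous f -> int_itv a b f = F b - F a.
Proof.
move=> ab dF cf.
have cF := is_derive_continuous dF.
rewrite /int_itv /intR /Rintegral -[RHS]/(fine ((F b)%:E - (F a)%:E)%E).
congr fine; rewrite -(@continuous_FTC2 R f F _ _ ab).
- rewrite -integral_itv_bndo_bndc; last first.
    by apply/measurable_EFinP; apply: measurable_funTS; exact: continuous_measurable_fun.
  rewrite [RHS]integral_mkcond; apply: eq_integral => x _.
  by rewrite /= patchE indicE; case: ifP => _; rewrite ?mulr1 ?mulr0.
- exact: continuous_subspaceT.
- split; first by move=> x _; have [] := dF x.
  + by apply: cvg_at_right_filter; exact: cF.
  + by apply: cvg_at_left_filter; exact: cF.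
- by move=> x _; rewrite derive1E; have [_ ->] := dF x.
Qed.

Lemma cvg_int_itv (u v : nat -> R) g : integrableR g ->
  (forall x, \forall n \near \oo, u n <= x < v n) ->
  int_itv (u n) (v n) g @[n --> \oo] --> intR g.
Proof.
move=> gi uv.
have [|||||//] := @intR_dominated _ (fun n x => g x * \1_(`[u n, v n[ : set R) x) g
  (fun x => `|g x|).
- by move=> n; apply: integrableR_meas; exact: integrable_itv.
- exact: integrableR_meas gi.
- apply: aeW => x; apply: cvg_near_cst; apply: filterS (uv x) => n un.
  by rewrite indicE mem_set ?mulr1//= in_itv.
- exact: integrableR_norm.
- move=> n x; rewrite normrM ler_piMr// indicE.
  by case: (_ \in _); rewrite ?normr1 ?normr0.
Qed.

Section Step.
Variables (F F' : R -> R) (d e : R).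
Hypotheses (d0 : 0 < d) (e0 : 0 < e).
Hypothesis dF : forall x, is_derive x 1 F (F' x).
Hypothesis cF' : continuous F'.
Hypotheses (F2i : integrableR (fun x => F x ^+ 2))
           (F'2i : integrableR (fun x => F' x ^+ 2)).

Let E x := e * F x ^+ 2 + d ^+ 2 / e * F' x ^+ 2.

Let Ei : integrableR E.
Proof. by apply: integrableRD; exact: integrableRZ. Qed.

Let E0 x : 0 <= E x.
Proof.
apply: addr_ge0; apply: mulr_ge0; rewrite ?sqr_ge0//; first exact: ltW.
by apply: divr_ge0; [exact: sqr_ge0|exact: ltW].
Qed.

(* [(a + d - y) F(y)^2] is an antiderivative of [2 (a + d - y) F F' - F^2]. *)
Lemma sampling_step a :
  int_itv a (a + d) (fun x => F x ^+ 2 - E x) <= d * F a ^+ 2 <=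
  int_itv a (a + d) (fun x => F x ^+ 2 + E x).
Proof.
pose W x := F x ^+ 2 - 2 * (a + d - x) * (F x * F' x).
have cF := is_derive_continuous dF.
have cW : continuous W.
  move=> x; apply: cvgB.
    exact: (@continuous_comp _ _ _ F (fun y : R => y ^+ 2) x (cF x) (@exprn_continuous R 2 (F x))).
  apply: cvgM; last by apply: cvgM; [exact: cF|exact: cF'].
  apply: cvgM; first exact: cvg_cst.
  by apply: cvgB; [exact: cvg_cst|exact: cvg_id].
have dW x : is_derive x 1 (fun x => - ((a + d - x) * F x ^+ 2)) (W x).
  by apply: is_derive_eq; rewrite /W /GRing.scale /=; ring.
have ad : a < a + d by rewrite ltrDl.
have WE : int_itv a (a + d) W = d * F a ^+ 2.
  by rewrite (int_itv_derive ad dW cW); ring.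
(* The arithmetic-geometric mean inequality with weight [e]; on the interval [a + d - x] is at most
   [d]. *)
have amgm x : a <= x < a + d -> `|2 * (a + d - x) * (F x * F' x)| <= E x.
  move=> /andP[ax xd]; rewrite /E.
  have q : 0 <= (e * F x - d * F' x) ^+ 2 /\ 0 <= (e * F x + d * F' x) ^+ 2.
    by split; exact: sqr_ge0.
  have H : 2 * d * `|F x * F' x| <= e * F x ^+ 2 + d ^+ 2 / e * F' x ^+ 2.
    rewrite -(ler_pM2l e0).
    have -> : e * (e * F x ^+ 2 + d ^+ 2 / e * F' x ^+ 2) = (e * F x) ^+ 2 + (d * F' x) ^+ 2.
      by field; rewrite gt_eqF.
    by case: (ger0P (F x * F' x)) => _; case: q => q1 q2; nra.
  apply: le_trans H; rewrite normrM ler_wpM2r// ger0_norm; lra.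
have mI : measurable_fun setT (\1_(`[a, a + d[ : set R) : R -> R) by exact: measurable_indic.
have mW := continuous_measurable_fun cW.
(* The weight [a + d - x] is unbounded on the line, so [W] is cut off to the interval before
   integrals are compared. *)
pose V x := W x * \1_(`[a, a + d[ : set R) x.
have VE : int_itv a (a + d) V = int_itv a (a + d) W.
  apply: eq_intR => x; rewrite /V indicE.
  by case: (_ \in _); rewrite ?mulr1 ?mulr0.
have Vi : integrableR V.
  apply: (@le_integrableR _ _ (fun x => F x ^+ 2 + E x)).
  - exact: measurable_funM.
  - move=> x; rewrite /V indicE mem_setE in_itv/=; case: (boolP (a <= x < a + d)) => [/amgm H|_].
      rewrite mulr1 /W; apply: le_trans (ler_normB _ _) _.
      by rewrite ger0_norm ?sqr_ge0// lerD2l.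
    by rewrite mulr0 normr0 addr_ge0// sqr_ge0.
  - exact: integrableRD.
have VI x : a <= x < a + d -> V x = W x.
  by move=> xad; rewrite /V indicE mem_set ?mulr1//= in_itv.
rewrite -WE -VE; apply/andP; split; apply: le_int_itv => //.
- exact: integrableRB.
- move=> x xad; rewrite VI// /W lerD2l lerN2.
  by apply: le_trans (amgm x xad); exact: ler_norm.
- exact: integrableRD.
- move=> x xad; rewrite VI// /W lerD2l.
  by apply: le_trans (amgm x xad); rewrite -normrN; exact: ler_norm.
Qed.

Lemma sampling_steps a n :
  int_itv a (a + n%:R * d) (fun x => F x ^+ 2 - E x)
    <= \sum_(i < n) d * F (a + i%:R * d) ^+ 2 <=
  int_itv a (a + n%:R * d) (fun x => F x ^+ 2 + E x).
Proof.
elim: n => [|n IH].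
  rewrite big_ord0 mul0r addr0.
  have Z g : int_itv a a g = 0.
    rewrite -[RHS](@intR0 R); apply: eq_intR => x; rewrite indicE mem_setE in_itv/=.
    by case: (leP a x) => /= ax; rewrite ?mulr0// ltNge ax mulr0.
  by rewrite !Z lexx.
have nE : a + n.+1%:R * d = a + n%:R * d + d by rewrite -natr1; ring.
have h1 : a <= a + n%:R * d by rewrite lerDl mulr_ge0// ltW.
have h2 : a + n%:R * d <= a + n%:R * d + d by rewrite lerDl ltW.
rewrite big_ord_recr /= nE (int_itv_cat h1 h2); last exact: integrableRB.
rewrite (int_itv_cat h1 h2); last exact: integrableRD.
have /andP[s1 s2] := sampling_step (a + n%:R * d); case/andP: IH => I1 I2.
by apply/andP; split; apply: lerD.
Qed.

Let total : R := intR (fun x => F x ^+ 2).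
Let error : R := e * total + d ^+ 2 / e * intR (fun x => F' x ^+ 2).

Let errorE : intR E = error.
Proof. by rewrite intRD; [rewrite !intRZ|exact: integrableRZ|exact: integrableRZ]. Qed.

Lemma sampling_le a n :
  \sum_(i < n) d * F (a + i%:R * d) ^+ 2 <= total + error.
Proof.
have /andP[_ h] := sampling_steps a n; apply: le_trans h _.
rewrite -errorE -intRD//; apply: le_intR.
- by apply: integrable_itv; exact: integrableRD.
- exact: integrableRD.
- move=> x; rewrite indicE; case: (_ \in _); rewrite ?mulr1// mulr0.
  by rewrite addr_ge0 ?sqr_ge0.
Qed.

(** Finite sums only approach the lower bound as their range exhausts the line, hence the arbitrary
    [r] below it. The lattice has mesh [d] and offset [c]. *)
Lemma sampling_ge c (r : R) : r < total - error ->
  exists n, r < \sum_(i < n.*2) d * F (d * ((i%:Z - n%:Z)%:~R + c)) ^+ 2.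
Proof.
move=> rt.
pose u n : R := d * (c - n%:R); pose v n : R := u n + n.*2%:R * d.
have uv x : \forall n \near \oo, u n <= x < v n.
  pose q := x / d - c.
  have xE : x = d * (q + c) by rewrite /q; field; rewrite gt_eqF.
  near=> n; have nE : v n = d * (c + n%:R) by rewrite /v /u -addnn natrD; ring.
  have nn : `|q| + 1 <= n%:R by near: n; exact: nbhs_infty_ger.
  rewrite nE /u xE (ler_pM2l d0) (ltr_pM2l d0).
  have := ler_norm q; have := ler_norm (- q); rewrite normrN; lra.
have := cvg_int_itv (integrableRB F2i Ei) uv; rewrite intRB// errorE -/total => cv.
have /cvgrPdist_lt/(_ (total - error - r)) := cv.
rewrite subr_gt0 => /(_ rt)[N _ /(_ N (leqnn _))] /= H.
exists N; apply: (@lt_le_trans _ _ (int_itv (u N) (v N) (fun x => F x ^+ 2 - E x))).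
  by move: H; rewrite ltr_norml; lra.
have /andP[h _] := sampling_steps (u N) N.*2; apply: le_trans h _.
rewrite le_eqVlt; apply/orP; left; apply/eqP; apply: eq_bigr => i _.
by congr (_ * F _ ^+ 2); rewrite /u rmorphB /=; ring.
Unshelve. all: by end_near. Qed.

End Step.
End Sampling.

(** * Derivatives of Gaussians *)

Section GaussianDerivatives.
Context {R : realType}.
Implicit Types (s t x y lam phi : R) (l m : nat).

Lemma is_derive_cosT_pow_gauss s l phi t : 0 < s ->
  is_derive t 1 (cosT (phi + l%:R * (pi / 2)) (fun x => x ^+ l * gauss s x))
    (cosT (phi + l.+1%:R * (pi / 2)) (fun x => x ^+ l.+1 * gauss s x) t).
Proof.
move=> s0; have li := integrable_pow_gauss l s0.
have lSi : integrableR (fun x => x * (x ^+ l * gauss s x)).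
  by apply: eq_integrableR (integrable_pow_gauss l.+1 s0) => x; rewrite exprS mulrA.
have dC := is_derive_cosT (phi + l%:R * (pi / 2)) t li lSi.
rewrite (_ : phi + l.+1%:R * (pi / 2) = phi + l%:R * (pi / 2) + pi / 2); last first.
  by rewrite -natr1; ring.
apply: is_derive_eq; apply: eq_intR => x; by rewrite exprS mulrA.
Qed.

Lemma sin_natmul_pi l : sin (l%:R * pi : R) = 0.
Proof.
elim: l => [|l IH]; first by rewrite mul0r sin0.
by rewrite -natr1 mulrDl mul1r sinD IH sinpi mulr0 mul0r addr0.
Qed.

(** The left side is the [l]-th derivative in [t] of the transform of [gauss s] with phase [phi],
    which vanishes identically by [cosT_gauss]. *)
Lemma cosT_pow_gauss_eq0 s l phi t : 0 < s -> cos phi = 0 ->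
  cosT (phi + l%:R * (pi / 2)) (fun x => x ^+ l * gauss s x) t = 0.
Proof.
move=> s0 phi0; elim: l t => [|l IH] t.
  rewrite mul0r addr0 (_ : (fun x => x ^+ 0 * gauss s x) = gauss s).
    by rewrite cosT_gauss// phi0 !mul0r.
  by apply/funext => x; rewrite expr0 mul1r.
have [_ <-] := is_derive_cosT_pow_gauss l phi t s0.
rewrite (_ : cosT _ _ = cst 0) ?derive_cst//.
by apply/funext => u; rewrite IH.
Qed.

(** In effect the substitution of [lam * x] for the variable. It is checked on the closed form for
    [l = 0], and each differentiation in [t] raises [l] by one. *)
Lemma cosT_pow_gauss_dilate s l phi lam t : 0 < s -> 0 < lam ->
  cosT (phi + l%:R * (pi / 2)) (fun x => x ^+ l * gauss s x) (lam * t) =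
  (lam ^+ l.+1)^-1 *
  cosT (phi + l%:R * (pi / 2)) (fun x => x ^+ l * gauss (s / lam ^+ 2) x) t.
Proof.
move=> s0 lam0; have s'0 : 0 < s / lam ^+ 2 by rewrite divr_gt0// exprn_gt0.
elim: l t => [|l IH] t.
  have E (r : R) : (fun x => x ^+ 0 * gauss r x) = gauss r.
    by apply/funext => x; rewrite expr0 mul1r.
  rewrite mul0r addr0 !E !cosT_gauss// expr1.
  rewrite (_ : pi / (s / lam ^+ 2) = lam ^+ 2 * (pi / s)); last first.
    by move: (pi : R) => q; field; rewrite !gt_eqF.
  rewrite [Num.sqrt (lam ^+ 2 * _)]sqrtrM ?sqr_ge0// sqrtr_sqr gtr0_norm//.
  rewrite (_ : t ^+ 2 / (4 * (s / lam ^+ 2)) = (lam * t) ^+ 2 / (4 * s)); last first.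
    by field; rewrite !gt_eqF.
  move: (cos _) (Num.sqrt _) (expR _) => u v w; by field; rewrite gt_eqF.
set A := cosT _ _ in IH; set B := cosT _ _ in IH.
have dA := is_derive_cosT_pow_gauss l phi (lam * t) s0.
have dB := is_derive_cosT_pow_gauss l phi t s'0.
have dA' : is_derive t 1 (fun u => A (lam * u))
    (lam * cosT (phi + l.+1%:R * (pi / 2)) (fun x => x ^+ l.+1 * gauss s x) (lam * t)).
  have dl : is_derive t 1 (fun u => lam * u) lam.
    by apply: is_derive_eq; rewrite /GRing.scale /=; ring.
  by have := @is_derive1_comp _ A (fun u => lam * u) t _ _ dA dl; rewrite mulrC.
have dB' : is_derive t 1 (fun u => (lam ^+ l.+1)^-1 * B u)
    ((lam ^+ l.+1)^-1 * cosT (phi + l.+1%:R * (pi / 2))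
      (fun x => x ^+ l.+1 * gauss (s / lam ^+ 2) x) t).
  by apply: is_derive_eq; rewrite /GRing.scale /=; ring.
have AB : (fun u => A (lam * u)) = (fun u => (lam ^+ l.+1)^-1 * B u) by apply/funext.
rewrite AB in dA'; have [_ dBE] := dB'; have [_] := dA'; rewrite dBE => H.
apply: (mulfI (lt0r_neq0 lam0)); rewrite -H [lam ^+ l.+2]exprS [(lam * _)^-1]invfM -mulrA.
by rewrite [RHS]mulrA divff ?mul1r// gt_eqF.
Qed.

(** Starting from [cosT_gauss] with phase 0, each derivative contributes a factor [x] under the
    integral and a quarter turn of the phase. *)
Lemma derive1n_scale_gauss c s l t : 0 < s ->
  derive1n l (fun t => c * expR (- (t ^+ 2 / (4 * s)))) t =
  c / Num.sqrt (pi / s) * cosT (l%:R * (pi / 2)) (fun x => x ^+ l * gauss s x) t.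
Proof.
move=> s0; have q0 : Num.sqrt (pi / s) != 0 :> R.
  by rewrite gt_eqF// sqrtr_gt0 divr_gt0 ?pi_gt0.
elim: l t => [|l IH] t.
  rewrite derive1n0 mul0r (_ : (fun x => x ^+ 0 * gauss s x) = gauss s); last first.
    by apply/funext => x; rewrite expr0 mul1r.
  by rewrite cosT_gauss// cos0 mul1r mulrA divfK.
rewrite derive1nS derive1E.
have -> : derive1n l (fun t => c * expR (- (t ^+ 2 / (4 * s)))) =
  (fun t => c / Num.sqrt (pi / s) * cosT (l%:R * (pi / 2)) (fun x => x ^+ l * gauss s x) t).
  by apply/funext.
have := is_derive_cosT_pow_gauss l 0 t s0; rewrite !add0r => dC.
have dC' : is_derive t 1
    (fun t => c / Num.sqrt (pi / s) *
      cosT (l%:R * (pi / 2)) (fun x => x ^+ l * gauss s x) t)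
    (c / Num.sqrt (pi / s) *
      cosT (l.+1%:R * (pi / 2)) (fun x => x ^+ l.+1 * gauss s x) t).
  by apply: is_derive_eq; rewrite /GRing.scale /=; ring.
by have [_ ->] := dC'.
Qed.

(* The difference of the two sides is half the transform of an odd function. *)
Lemma cosT_pow_gauss_split s l x y : 0 < s ->
  cosT (l%:R * (pi / 2)) (fun z => z ^+ l * gauss s z) (x - y) =
  2 * cosT (pi / 4) (fun z => z ^+ l * gauss s z *
    cos (z * y + (pi / 4 - l%:R * (pi / 2)))) x.
Proof.
move=> s0; have li := integrable_pow_gauss l s0.
have h0 : cos (pi / 2 - l%:R * pi) = 0 :> R.
  by rewrite cosB cos_pihalf sin_natmul_pi mul0r mulr0 addr0.
have Z := cosT_pow_gauss_eq0 l (x + y) s0 h0.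
rewrite -[LHS]addr0 -[X in _ + X]Z -intRD; [|exact: integrable_cosT|exact: integrable_cosT].
rewrite -intRZ; last by apply: integrable_cosT; exact: integrable_cosT.
apply: eq_intR => z.
rewrite (_ : z * (x - y) + l%:R * (pi / 2) =
  (z * x + pi / 4) - (z * y + (pi / 4 - l%:R * (pi / 2)))); last by ring.
rewrite (_ : z * (x + y) + (pi / 2 - l%:R * pi + l%:R * (pi / 2)) =
  (z * x + pi / 4) + (z * y + (pi / 4 - l%:R * (pi / 2)))); last by field.
move: (z * x + pi / 4) (z * y + _) => u v; rewrite cosB cosD; ring.
Qed.

End GaussianDerivatives.

(** * Wavelet coefficients *)

Section WaveletCoefficients.
Context {R : realType}.
Local Notation mu := (@lebesgue_measure R).
Implicit Types (m l : nat) (n k : int) (x y z : R).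

Definition rwavelet m l n k x : R :=
  2 `^ (n%:~R / 2) * @Gderiv R m l (2 ^ n * x - k%:~R).

(** The value of [s] for which [t ^+ 2 / (4 * s)] is the exponent 12 t^2 / (2m - l) of
    [Gauss m l]. *)
Definition width m l : R := (2 * m%:R - l%:R) / 48.

(* The cosine product formula with phases [pi / 4] and [phase l] yields
   [cos (z (x - y) + l pi / 2)] plus a term that is odd against [z ^+ l * gauss s z]. *)
Definition phase l : R := pi / 4 - l%:R * (pi / 2).

Definition node m n k : R := (2 ^ n)^-1 * (k%:~R + (odd m)%:R / 2).

(** Collects the normalisation of the wavelet, the constant of [derive1n_scale_gauss], the dilation
    factor of [cosT_pow_gauss_dilate] and the 2 of [cosT_pow_gauss_split]. *)
Definition wavelet_scale m l n : R :=
  2 `^ (n%:~R / 2) * (@Gconst R m l / Num.sqrt (pi / width m l)) / (2 ^ n) ^+ l.+1 * 2.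

Definition scaled_width m l n : R := width m l / (2 ^ n) ^+ 2.

Lemma width_gt0 m l : (0 < l <= m)%N -> 0 < width m l.
Proof.
move=> /andP[l0 lm]; rewrite divr_gt0// subr_gt0 -natrM ltr_nat; lia.
Qed.

Lemma pow2z_gt0 n : 0 < 2 ^ n :> R. Proof. by rewrite exprz_gt0. Qed.

Lemma scaled_width_gt0 m l n : (0 < l <= m)%N -> 0 < scaled_width m l n.
Proof. by move=> lm; rewrite divr_gt0 ?width_gt0// exprn_gt0// pow2z_gt0. Qed.

(** The variable [x] sits in a transform of fixed phase [pi / 4], and the translate enters only
    through the node in the other cosine; the transform can then be moved onto the signal. *)
Lemma rwavelet_cosT m l n k x : (0 < l <= m)%N ->
  rwavelet m l n k x = wavelet_scale m l n *
  cosT (pi / 4) (fun z => z ^+ l * gauss (scaled_width m l n) z *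
    cos (z * node m n k + phase l)) x.
Proof.
move=> lm; have s0 := width_gt0 lm; have lam0 := pow2z_gt0 n.
rewrite /rwavelet /Gderiv.
have -> : @Gauss R m l = (fun t => @Gconst R m l * expR (- (t ^+ 2 / (4 * width m l)))).
  apply/funext => t; rewrite /Gauss /width; congr (_ * expR (- _)).
  by field; move: s0; rewrite /width => s0; rewrite gt_eqF//; lra.
rewrite derive1n_scale_gauss//.
have -> : 2 ^ n * x - k%:~R - (odd m)%:R / 2 = 2 ^ n * (x - node m n k).
  by rewrite /node mulrBr mulVKf ?gt_eqF//; ring.
have := cosT_pow_gauss_dilate l 0 (x - node m n k) s0 lam0; rewrite !add0r => ->.
rewrite cosT_pow_gauss_split; last exact: scaled_width_gt0.
by rewrite /wavelet_scale /scaled_width -/(phase l); ring.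
Qed.

Lemma Gconst_sqr m l : (0 < l <= m)%N ->
  (@Gconst R m l / Num.sqrt (pi / width m l)) ^+ 2 =
  'C(m, l)%:R / (4 * pi ^+ 2 * 16 ^+ l).
Proof.
move=> lm; have s0 := width_gt0 lm; have p0 := pi_gt0 R.
have ml0 : 0 < m%:R - l%:R / 2 :> R by move: s0; rewrite /width => s0; lra.
rewrite /Gconst expr_div_n !exprMn !exprVn exprMn !sqr_sqrtr ?divr_ge0 ?ltW//.
rewrite -exprM mulnC exprM (_ : 4 ^+ 2 = 16 :> R); last by ring.
rewrite /width; have h0 : 0 < 16 ^+ l :> R by rewrite exprn_gt0.
move: (pi : R) p0 ('C(m, l)%:R : R) (16 ^+ l : R) h0 => q q0 b u u0.
- by field; apply/and3P; split; rewrite gt_eqF//; lra.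
- lra.
- by rewrite ltr0n bin_gt0; lia.
Qed.

(** The square of [wavelet_scale m l n] without the factor [(2 ^ n)^-1], which is set aside as the
    mesh of the Riemann sum. *)
Definition symbol_coef m l n : R := 'C(m, l)%:R / (pi ^+ 2 * 16 ^+ l * (2 ^ n) ^+ (2 * l)).

Lemma wavelet_scale_sqr m l n : (0 < l <= m)%N ->
  wavelet_scale m l n ^+ 2 = symbol_coef m l n * (2 ^ n)^-1.
Proof.
move=> lm; have lam0 := pow2z_gt0 n; have p0 := pi_gt0 R.
rewrite /wavelet_scale; have := Gconst_sqr lm; move: (_ / Num.sqrt _) => c cE.
rewrite !exprMn cE.
have -> : (2 `^ (n%:~R / 2)) ^+ 2 = 2 ^ n :> R.
  rewrite -powR_mulrn ?powR_ge0// -powRrM divfK// -powR_intmul//.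
rewrite exprVn -exprM (_ : (l.+1 * 2 = (2 * l).+2)%N); last by lia.
rewrite /symbol_coef !exprS; have h0 : 0 < 16 ^+ l :> R by rewrite exprn_gt0.
have h1 : 0 < (2 ^ n) ^+ (2 * l) :> R by rewrite exprn_gt0.
move: (pi : R) p0 ('C(m, l)%:R : R) (16 ^+ l : R) h0 (2 ^ n : R) lam0 ((2 ^ n) ^+ (2 * l) : R) h1.
move=> q q0 b u u0 lam lam0 v v0; field; by rewrite !gt_eqF.
Qed.

Lemma cos_phase2 l : cos (2 * phase l) = 0.
Proof.
rewrite (_ : 2 * phase l = pi / 2 - l%:R * pi); last by rewrite /phase; field.
by rewrite cosB cos_pihalf sin_natmul_pi mul0r mulr0 addr0.
Qed.

End WaveletCoefficients.

(** * Coefficients of one signal at one scale *)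

Section FixedFunction.
Context {R : realType}.
Local Notation mu := (@lebesgue_measure R).
Variables (f : R -> R) (M : R).
Hypotheses (fM : forall x, `|f x| <= M) (fi : integrableR f)
  (xfi : integrableR (fun x => x * f x))
  (fc : {ae mu, forall x, {for x, continuous f}}).

Definition spectrum (x : R) : R := cosT (pi / 4) f x ^+ 2.

Local Notation H := (cosT (pi / 4) f).

Lemma continuous_transform : continuous H.
Proof. by apply: is_derive_continuous => x; exact: is_derive_cosT. Qed.

Lemma cos_2pi4 : cos (2 * (pi / 4)) = 0 :> R.
Proof. by rewrite (_ : 2 * (pi / 4) = pi / 2) ?cos_pihalf//; field. Qed.

Lemma spectrum_plancherel : integrableR spectrum /\
  intR spectrum = pi * intR (fun x => f x ^+ 2).
Proof. exact: (cosT_plancherel cos_2pi4 fi fM fc). Qed.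

Lemma spectrum_ge0 x : 0 <= spectrum x. Proof. exact: sqr_ge0. Qed.

Definition filtered (s : R) (l : nat) (z : R) : R := z ^+ l * gauss s z * H z.

Lemma filtered_bounded s l : 0 < s -> exists C, forall z, `|filtered s l z| <= C.
Proof.
move=> s0; have [C C0 HC] := pow_gauss_bounded l s0.
exists (C * intR (fun x => `|f x|)) => z.
by rewrite normrM ler_pM// cosT_bound.
Qed.

Lemma integrable_filtered s l : 0 < s -> integrableR (filtered s l).
Proof.
move=> s0; apply: (integrableRM (integrable_pow_gauss l s0)).
  exact: measurable_cosT.
by move=> x; exact: cosT_bound.
Qed.

Lemma continuous_filtered s l : continuous (filtered s l).
Proof.
move=> x; apply: cvgM; last exact: continuous_transform.
by apply: cvgM; [exact: exprn_continuous|exact: continuous_gauss].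
Qed.

Lemma filtered_plancherel (s : R) l (psi : R) : 0 < s -> cos (2 * psi) = 0 ->
  integrableR (fun y => cosT psi (filtered s l) y ^+ 2) /\
  intR (fun y => cosT psi (filtered s l) y ^+ 2) =
  pi * intR (fun x => filtered s l x ^+ 2).
Proof.
move=> s0 psi0; have [C HC] := filtered_bounded l s0.
apply: (cosT_plancherel psi0 (integrable_filtered l s0) HC).
by apply: aeW => x; exact: continuous_filtered.
Qed.

Lemma integrable_filtered_sqr s l : 0 < s -> integrableR (fun x => filtered s l x ^+ 2).
Proof.
move=> s0; have [C HC] := filtered_bounded l s0.
have hi := integrable_filtered l s0.
by apply: eq_integrableR (integrableRM hi (integrableR_meas hi) HC) => x; rewrite expr2.
Qed.

Lemma is_derive_filtered (s : R) l (psi y : R) : 0 < s ->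
  is_derive y 1 (cosT psi (filtered s l)) (cosT (psi + pi / 2) (filtered s l.+1) y).
Proof.
move=> s0; have E : (fun x => x * filtered s l x) = filtered s l.+1.
  by apply/funext => x; rewrite /filtered exprS !mulrA.
rewrite -E; apply: is_derive_cosT; first exact: integrable_filtered.
by rewrite E; exact: integrable_filtered.
Qed.

(** Once the transform is moved onto [f], the coefficients with given [l] and [n] are samples of a
    single function at the nodes, so the sum of their squares over [k] is a Riemann sum. *)
Lemma wavelet_coef m l n k : (0 < l <= m)%N ->
  intR (fun x => f x * rwavelet m l n k x) =
  wavelet_scale m l n * cosT (phase l) (filtered (scaled_width m l n) l) (node m n k).
Proof.
move=> lm; have s0 := @scaled_width_gt0 R m l n lm.
pose b (z : R) := z ^+ l * gauss (scaled_width m l n) z * cos (z * node m n k + phase l).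
have bi : integrableR b by apply: integrable_cosT; exact: integrable_pow_gauss.
have bfi : integrableR (fun x => f x * cosT (pi / 4) b x).
  apply: (integrableRM fi); first exact: measurable_cosT.
  by move=> x; exact: cosT_bound.
transitivity (intR (fun x => wavelet_scale m l n * (f x * cosT (pi / 4) b x))).
  by apply: eq_intR => x; rewrite rwavelet_cosT// mulrCA.
rewrite intRZ// cosT_swap//; congr (_ * _); apply: eq_intR => z.
by rewrite /b /filtered mulrAC.
Qed.

Definition level (n : int) (w : R) : R := w ^+ 2 / (16 * (2 ^ n) ^+ 2).

(** The quadratic form of multiplication by [g] on the frequency side, normalised so that the
    constant 1 yields the squared norm of [f]. *)
Definition average (g : R -> R) : R := pi^-1 * intR (fun w => g w * spectrum w).

Lemma level_ge0 n w : 0 <= level n w.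
Proof. by apply: divr_ge0; [|apply: mulr_ge0]; rewrite ?sqr_ge0. Qed.

Lemma symbol_coef_filtered m l n w : (0 < l <= m)%N ->
  symbol_coef m l n * (pi * filtered (scaled_width m l n) l w ^+ 2) =
  pi^-1 * (symbol_term m l (level n w) * spectrum w).
Proof.
move=> lm; have p0 := pi_gt0 R; have lam0 := @pow2z_gt0 R n.
rewrite /filtered exprMn -/(spectrum w) exprMn -exprM.
have -> : gauss (scaled_width m l n) w ^+ 2 =
    expR (- (2 / 3 * (2 * m%:R - l%:R) * level n w)).
  rewrite /gauss -expRM_natl; congr expR; rewrite /scaled_width /width /level.
  by field; rewrite gt_eqF.
rewrite /symbol_term /symbol_coef /level expr_div_n [(16 * _) ^+ l]exprMn.
rewrite -[((2 ^ n) ^+ 2) ^+ l]exprM -[(w ^+ 2) ^+ l]exprM [(l * 2)%N]mulnC.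
have h0 : 0 < 16 ^+ l :> R by rewrite exprn_gt0.
have h1 : 0 < (2 ^ n) ^+ (2 * l) :> R by rewrite exprn_gt0.
move: (expR _) (spectrum w) (w ^+ (2 * l)) => u v x.
move: (pi : R) p0 ('C(m, l)%:R : R) (16 ^+ l : R) h0 ((2 ^ n) ^+ (2 * l) : R) h1.
by move=> q q0 b c c0 d d0; field; rewrite !gt_eqF.
Qed.

Definition term_error m l n (e w : R) : R :=
  symbol_term m l (level n w) * (e + 16 * level n w / e).

Let sq_sum m l n (e w : R) : (0 < l <= m)%N ->
  symbol_coef m l n * (pi * (e * filtered (scaled_width m l n) l w ^+ 2 +
    (2 ^ n)^-1 ^+ 2 / e * filtered (scaled_width m l n) l.+1 w ^+ 2)) =
  pi^-1 * (term_error m l n e w * spectrum w).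
Proof.
move=> lm; have lam0 := @pow2z_gt0 R n.
have -> : filtered (scaled_width m l n) l.+1 w = w * filtered (scaled_width m l n) l w.
  by rewrite /filtered exprS !mulrA.
transitivity ((e + 16 * level n w / e) *
    (symbol_coef m l n * (pi * filtered (scaled_width m l n) l w ^+ 2))).
  rewrite /level; move: (filtered _ _ _) (symbol_coef _ _ _) (pi : R) => u v q.
  rewrite (_ : 16 * (w ^+ 2 / (16 * (2 ^ n) ^+ 2)) = (2 ^ n)^-1 ^+ 2 * w ^+ 2); first by ring.
  by field; rewrite gt_eqF.
by rewrite symbol_coef_filtered// /term_error; ring.
Qed.

Section Scale.
Variables (m l : nat) (n : int) (e : R).
Hypotheses (lm : (0 < l <= m)%N) (e0 : 0 < e).

Let s := scaled_width m l n : R.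
Let s0 : 0 < s. Proof. exact: scaled_width_gt0. Qed.
Let d : R := (2 ^ n)^-1.
Let d0 : 0 < d. Proof. by rewrite invr_gt0 pow2z_gt0. Qed.

Let F := cosT (phase l) (filtered s l).
Let F' := cosT (phase l + pi / 2) (filtered s l.+1).

Let dF (x : R) : is_derive x 1 F (F' x). Proof. exact: is_derive_filtered. Qed.

Let cF' : continuous F'.
Proof. by apply: is_derive_continuous => x; exact: is_derive_filtered. Qed.

(** Differentiation advances the phase by [pi / 2], which only changes the sign of the cosine of the
    doubled phase, so Plancherel's formula applies to [F'] as well. *)
Let phase2' : cos (2 * (phase l + pi / 2)) = 0 :> R.
Proof.
rewrite mulrDr (_ : 2 * (pi / 2) = pi); last by field.
by rewrite cosD cospi sinpi cos_phase2 mul0r mulr0 subr0.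
Qed.

Let F2 := filtered_plancherel l s0 (cos_phase2 l).
Let F'2 := filtered_plancherel l.+1 s0 phase2'.

Let coefE k : intR (fun x => f x * rwavelet m l n k x) ^+ 2 =
  symbol_coef m l n * (d * F (node m n k) ^+ 2).
Proof. by rewrite wavelet_coef// exprMn wavelet_scale_sqr// -mulrA. Qed.

Let coef_ge0 : 0 <= symbol_coef m l n :> R.
Proof.
rewrite divr_ge0// !mulr_ge0 ?exprn_ge0 ?pi_ge0// ltW// exprz_gt0//.
Qed.

Let mainE : symbol_coef m l n * intR (fun x => F x ^+ 2) =
  average (fun w => symbol_term m l (level n w)).
Proof.
rewrite (proj2 F2) -!intRZ.
- rewrite /average -intRZ.
    by apply: eq_intR => w; rewrite symbol_coef_filtered.
  apply: eq_integrableR (integrableRZ (pi * (symbol_coef m l n * pi))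
    (integrable_filtered_sqr l s0)) => w.
  rewrite -mulrA -[_ * pi * _]mulrA symbol_coef_filtered// mulrA divff ?mul1r//.
  by rewrite gt_eqF// pi_gt0.
- by apply: integrableRZ; exact: integrable_filtered_sqr.
- exact: integrable_filtered_sqr.
Qed.

Let errorE : symbol_coef m l n *
    (e * intR (fun x => F x ^+ 2) + d ^+ 2 / e * intR (fun x => F' x ^+ 2)) =
  average (term_error m l n e).
Proof.
have i1 := integrable_filtered_sqr l s0; have i2 := integrable_filtered_sqr l.+1 s0.
rewrite (proj2 F2) (proj2 F'2) mulrCA [_ / e * _]mulrCA -mulrDr -!intRZ//.
have i12 : integrableR (fun w => e * filtered s l w ^+ 2 + d ^+ 2 / e * filtered s l.+1 w ^+ 2).
  by apply: integrableRD; exact: integrableRZ.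
rewrite -intRD; [|exact: integrableRZ|exact: integrableRZ].
rewrite -intRZ// -intRZ; last exact: integrableRZ.
rewrite /average -intRZ; first by apply: eq_intR => w; rewrite sq_sum.
apply: eq_integrableR (integrableRZ (pi * (symbol_coef m l n * pi)) i12) => w.
rewrite -mulrA -[_ * pi * _]mulrA sq_sum// mulrA divff ?mul1r//.
by rewrite gt_eqF// pi_gt0.
Qed.

Lemma scale_sum_le (N : nat) (k0 : int) :
  \sum_(i < N) intR (fun x => f x * rwavelet m l n (i%:Z + k0) x) ^+ 2 <=
  average (fun w => symbol_term m l (level n w)) + average (term_error m l n e).
Proof.
have := sampling_le d0 e0 dF cF' (proj1 F2) (proj1 F'2) (node m n k0) N.
move/(ler_wpM2l coef_ge0); rewrite mulrDr errorE mainE mulr_sumr.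
apply: le_trans; rewrite le_eqVlt; apply/orP; left; apply/eqP.
apply: eq_bigr => i _; rewrite coefE; congr (_ * (_ * F _ ^+ 2)).
by rewrite /node -/d rmorphD /=; ring.
Qed.

Lemma scale_sum_ge (r : R) :
  r < average (fun w => symbol_term m l (level n w)) - average (term_error m l n e) ->
  exists N, r < \sum_(i < N.*2) intR (fun x => f x * rwavelet m l n (i%:Z - N%:Z) x) ^+ 2.
Proof.
have c0 : 0 < symbol_coef m l n :> R.
  apply: divr_gt0; first by rewrite ltr0n bin_gt0; case/andP: lm.
  by rewrite !mulr_gt0 ?exprn_gt0 ?pi_gt0 ?pow2z_gt0.
move=> hr; have [|N HN] := sampling_ge d0 e0 dF cF' (proj1 F2) (proj1 F'2)
  ((odd m)%:R / 2) (r := r / symbol_coef m l n).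
  by rewrite ltr_pdivrMr// mulrC mulrBr errorE mainE.
exists N; move: HN; rewrite ltr_pdivrMr// => /lt_le_trans; apply.
rewrite mulrC mulr_sumr le_eqVlt; apply/orP; left; apply/eqP.
by apply: eq_bigr => i _; rewrite coefE; congr (_ * (_ * F _ ^+ 2)).
Qed.

End Scale.
End FixedFunction.

(** * Frame bounds on test functions *)

Section SumsOverIntegers.
Context {R : realType}.
Local Open Scope ereal_scope.

Lemma esum_ord m (b : 'I_m -> \bar R) : (forall l, 0 <= b l) ->
  \esum_(l in [set: 'I_m]) b l = \sum_(l < m) b l.
Proof.
move=> b0; rewrite esum_fset//; last exact: finite_finset.
rewrite -[RHS]big_enum /= [RHS]fsbig_seq ?enum_uniq//.
rewrite (_ : [set` enum 'I_m] = setT)//.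
by apply/seteqP; split => l //= _; rewrite mem_enum.
Qed.

Lemma int_range_uniq (N : nat) (k0 : int) :
  uniq [seq (i%:Z - k0)%R | i <- iota 0 N].
Proof. by rewrite map_inj_uniq ?iota_uniq// => i j /addIr []. Qed.

Lemma esum_int_ge (a : int -> \bar R) (N : nat) (k0 : int) : (forall k, 0 <= a k) ->
  \sum_(i < N) a (i%:Z - k0)%R <= \esum_(k in [set: int]) a k.
Proof.
move=> a0; apply: esum_ge; exists [set` [seq (i%:Z - k0)%R | i <- iota 0 N]].
  by split => //; exact: finite_seq.
rewrite -fsbig_seq ?int_range_uniq// big_map.
by rewrite -(big_mkord xpredT (fun i => a (i%:Z - k0)%R)) /index_iota subn0.
Qed.

(** Every finite set of integers lies in some window from -N to N - 1. *)
Lemma esum_int_le (a : int -> \bar R) (C : \bar R) : (forall k, 0 <= a k) ->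
  (forall N : nat, \sum_(i < N.*2) a (i%:Z - N%:Z)%R <= C) ->
  \esum_(k in [set: int]) a k <= C.
Proof.
move=> a0 aC; apply: ge_ereal_sup => _ [X [Xfin _] <-].
have /finite_seqP[s Xs] := Xfin.
have [N XN] : exists N, forall k, X k -> (`|k| < N)%N.
  exists (\sum_(k <- s) `|k|%N).+1 => k; rewrite Xs /= => ks.
  by rewrite ltnS (big_rem k) ?leq_addr.
apply: le_trans (aC N).
rewrite -(big_mkord xpredT (fun i => a (i%:Z - N%:Z)%R)) /index_iota subn0.
rewrite -(big_map (fun i => (i%:Z - N%:Z)%R) xpredT a) [leRHS]fsbig_seq ?int_range_uniq//.
apply: lee_fsum_nneg_subset => // k; rewrite !inE => /XN kN.
apply/mapP; exists `|(k + N%:Z)%R|%N; last by lia.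
by rewrite mem_iota; lia.
Qed.

Lemma lee_real_below (x : R) (y : \bar R) : (forall r : R, (r < x)%R -> r%:E <= y) -> x%:E <= y.
Proof.
move=> H; rewrite leNgt; apply/negP.
case: y H => [y| |] H; rewrite ?ltNge ?leey//.
  rewrite -ltNge lte_fin => yx; have := H ((x + y) / 2)%R.
  rewrite lee_fin; lra.
have : (x - 1)%:E <= -oo :> \bar R by apply: H; lra.
by rewrite leeNy_eq.
Qed.

(** Puts the scale outermost: the telescoping takes place after all [l] and [k] of a scale have been
    summed. *)
Lemma esum_triple m (a : 'I_m -> int -> int -> \bar R) : (forall l n k, 0 <= a l n k) ->
  \esum_(j in [set: 'I_m * int * int]) a j.1.1 j.1.2 j.2 =
  \esum_(n in [set: int]) \sum_(l < m) \esum_(k in [set: int]) a l n k.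
Proof.
move=> a0; rewrite esum_sum; last by move=> *; exact: esum_ge0.
rewrite -esum_ord; last by move=> *; apply: esum_ge0 => *; exact: esum_ge0.
rewrite (@esum_esum _ _ _ setT (fun=> setT) (fun l n => \esum_(k in setT) a l n k)); last first.
  by move=> *; exact: esum_ge0.
rewrite (@esum_esum _ _ _ _ (fun=> setT) (fun p k => a p.1 p.2 k))//.
by congr (esum _ _); apply/seteqP; split.
Qed.

End SumsOverIntegers.

(** * Frame bounds for a fixed test function *)

Section NiceFrame.
Context {R : realType}.
Local Notation mu := (@lebesgue_measure R).
Variables (f : R -> R) (M : R).
Hypotheses (fM : forall x, `|f x| <= M) (fi : integrableR f)
  (xfi : integrableR (fun x => x * f x))
  (fc : {ae mu, forall x, {for x, continuous f}}).

Local Notation W := (spectrum f).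
Local Notation avg := (average f).
Local Notation energy := (intR (fun x => f x ^+ 2)).

Lemma integrable_average (g : R -> R) (C : R) : measurable_fun setT g -> (forall w, `|g w| <= C) ->
  integrableR (fun w => g w * W w).
Proof.
move=> mg gC; have [Wi _] := spectrum_plancherel fM fi fc.
by apply: eq_integrableR (integrableRM Wi mg gC) => w; rewrite mulrC.
Qed.

Lemma average_cst (c : R) : avg (fun=> c) = c * energy.
Proof.
have [Wi WE] := spectrum_plancherel fM fi fc; have p0 := pi_gt0 R.
by rewrite /average intRZ// WE mulrCA mulKf// gt_eqF.
Qed.

Lemma le_average (g1 g2 : R -> R) : integrableR (fun w => g1 w * W w) ->
  integrableR (fun w => g2 w * W w) -> (forall w, g1 w <= g2 w) -> avg g1 <= avg g2.
Proof.
move=> i1 i2 g12; have p0 := pi_gt0 R.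
rewrite ler_wpM2l ?invr_ge0 ?(ltW p0)//; apply: le_intR => // w.
by rewrite ler_wpM2r// spectrum_ge0.
Qed.

Lemma average_sum (I : Type) (s : seq I) (g : I -> R -> R) :
  (forall i, integrableR (fun w => g i w * W w)) ->
  \sum_(i <- s) avg (g i) = avg (fun w => \sum_(i <- s) g i w).
Proof.
move=> gi; rewrite /average -mulr_sumr -intR_sum//; congr (_ * _).
by apply: eq_intR => w; rewrite mulr_suml.
Qed.

Lemma averageD (g1 g2 : R -> R) : integrableR (fun w => g1 w * W w) ->
  integrableR (fun w => g2 w * W w) -> avg g1 + avg g2 = avg (fun w => g1 w + g2 w).
Proof.
move=> i1 i2; rewrite /average -mulrDr -intRD//; congr (_ * _).
by apply: eq_intR => w; rewrite mulrDl.
Qed.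

Lemma averageB (g1 g2 : R -> R) : integrableR (fun w => g1 w * W w) ->
  integrableR (fun w => g2 w * W w) -> avg g1 - avg g2 = avg (fun w => g1 w - g2 w).
Proof.
move=> i1 i2; rewrite /average -mulrBr -intRB//; congr (_ * _).
by apply: eq_intR => w; rewrite mulrBl.
Qed.

Lemma measurable_level (n : int) : measurable_fun setT (@level R n).
Proof. by apply: measurable_funM => //; exact: measurable_funX. Qed.

Lemma measurable_symbol_term m l n :
  measurable_fun setT (fun w : R => symbol_term m l (level n w)).
Proof.
have ml := measurable_level n.
apply: measurable_funM; last first.
  apply: measurableT_comp => //; apply: measurableT_comp => //.
  exact: measurable_funM.
by apply: measurable_funM => //; exact: measurable_funX.
Qed.

Section FixedOrder.
Variables (m : nat) (e : R).
Hypotheses (m2 : (2 <= m)%N) (e0 : 0 < e).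

Let err : R := scale_error m.

(** Bounds the sum over the scales of S(t) (e + 16 t / e): the values S(t) add up to at most 1 +
    err, and t S(t) to at most err. *)
Definition frame_error : R := e * (1 + err) + 16 * err / e.

Lemma symbol_le (t : R) : 0 <= t -> symbol m t <= 1 + err.
Proof.
move=> t0; have := symbol_approx m2 t0; rewrite ler_norml => /andP[_].
have := scale_tail_telescope m 1 t0; rewrite big_ord1 expr0 mul1r => h.
have h1 := ler_wpM2l (scale_error_ge0 m : 0 <= err) h; rewrite mulr1 in h1.
have : scale_main m t <= 1.
  by rewrite -[leRHS]expR0 ler_expR oppr_le0 !mulr_ge0.
have := expR_gt0 (- (m%:R / 3 * (4 * t))); rewrite -/(scale_main m (4 * t)).
rewrite -/err in h1 *; lra.
Qed.

Lemma mul_symbol_bounded (t : R) : 0 <= t -> t * symbol m t <= err.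
Proof.
move=> t0; have := mul_symbol_sum_le 1 m2 t0.
by rewrite big_ord1 expr0 mul1r.
Qed.

Lemma symbol_term_le_symbol (l : 'I_m) (t : R) : 0 <= t ->
  symbol_term m l.+1 t <= symbol m t.
Proof.
move=> t0; rewrite /symbol (bigD1 l)//= lerDl sumr_ge0// => i _.
exact: symbol_term_ge0.
Qed.

Lemma integrable_symbol_term (l : 'I_m) n :
  integrableR (fun w => symbol_term m l.+1 (level n w) * W w).
Proof.
apply: (@integrable_average _ (1 + err)); first exact: measurable_symbol_term.
move=> w; have t0 := level_ge0 n w.
by rewrite ger0_norm ?symbol_term_ge0// (le_trans (symbol_term_le_symbol l t0))// symbol_le.
Qed.

Lemma integrable_term_error (l : 'I_m) n :
  integrableR (fun w => term_error m l.+1 n e w * W w).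
Proof.
apply: (@integrable_average _ frame_error).
  apply: measurable_funM; first exact: measurable_symbol_term.
  apply: measurable_funD => //; apply: measurable_funM => //.
  by apply: measurable_funM => //; exact: measurable_level.
move=> w; have t0 := level_ge0 n w.
have T0 := symbol_term_ge0 m l.+1 t0; have Tl := symbol_term_le_symbol l t0.
have c0 : 0 <= e + 16 * level n w / e.
  by apply: addr_ge0; [exact: ltW|apply: divr_ge0; [exact: mulr_ge0|exact: ltW]].
rewrite /term_error ger0_norm; last exact: mulr_ge0.
apply: le_trans (ler_wpM2r c0 Tl) _.
have -> : symbol m (level n w) * (e + 16 * level n w / e) =
    e * symbol m (level n w) + 16 * (level n w * symbol m (level n w)) / e.
  by field; rewrite gt_eqF.
apply: lerD; first by apply: ler_wpM2l; [exact: ltW|exact: symbol_le].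
by rewrite ler_wpM2r ?invr_ge0 ?(ltW e0)// ler_wpM2l// mul_symbol_bounded.
Qed.

Let N1 (N : nat) (w : R) : R := level (N%:Z - 1) w.

(** The level drops by a factor 4 when the scale grows by one, so the window is listed from scale N
    - 1 down to -N. *)
Lemma level_octave (N : nat) (i : 'I_N.*2) (w : R) :
  level ((rev_ord i)%:Z - N%:Z) w = 4 ^+ i * N1 N w.
Proof.
have -> : (rev_ord i)%:Z - N%:Z = (N%:Z - 1) - i%:Z by rewrite /=; have := ltn_ord i; lia.
rewrite /N1 /level expfzDr// exprMn -invr_expz.
have lam0 := @pow2z_gt0 R (N%:Z - 1).
rewrite (_ : (2 ^ i%:Z)^-1 ^+ 2 = (4 ^+ i)^-1 :> R).
  have h : 0 < 4 ^+ i :> R by rewrite exprn_gt0.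
  by move: (4 ^+ i : R) h => q q0; field; rewrite !gt_eqF.
rewrite exprVn -exprM mulnC exprM; congr (_ ^+ i)^-1; ring.
Qed.

Lemma sum_symbol_terms (N : nat) (w : R) :
  \sum_(i < N.*2) \sum_(l < m) symbol_term m l.+1 (level (i%:Z - N%:Z) w) =
  \sum_(i < N.*2) symbol m (4 ^+ i * N1 N w).
Proof.
rewrite (reindex_inj rev_ord_inj) /=; apply: eq_bigr => i _.
by have := level_octave i w; rewrite /= => ->.
Qed.

Lemma sum_term_errors (N : nat) (w : R) :
  \sum_(i < N.*2) \sum_(l < m) term_error m l.+1 (i%:Z - N%:Z) e w <= frame_error.
Proof.
have s0 : 0 <= N1 N w by exact: level_ge0.
rewrite (reindex_inj rev_ord_inj) /=.
have E (i : 'I_N.*2) : \sum_(l < m) term_error m l.+1 ((N.*2 - i.+1)%N%:Z - N%:Z) e w =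
    e * symbol m (4 ^+ i * N1 N w) +
    16 / e * (4 ^+ i * N1 N w * symbol m (4 ^+ i * N1 N w)).
  rewrite /term_error -mulr_suml; have := level_octave i w; rewrite /= => ->.
  by rewrite -/(symbol _ _); field; rewrite gt_eqF.
under eq_bigr do rewrite E.
rewrite big_split -!mulr_sumr /= lerD//.
  rewrite ler_wpM2l ?(ltW e0)//.
  have := symbol_telescope N.*2 m2 s0; rewrite ler_norml => /andP[_].
  have : scale_main m (N1 N w) <= 1.
    rewrite -[leRHS]expR0 ler_expR oppr_le0; apply: mulr_ge0 => //; exact: divr_ge0.
  have := expR_gt0 (- (m%:R / 3 * (4 ^+ N.*2 * N1 N w))).
  rewrite -/(scale_main m _) -/err; lra.
rewrite [leRHS]mulrAC ler_wpM2l ?divr_ge0 ?(ltW e0)//.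
exact: mul_symbol_sum_le.
Qed.

Local Notation coef l n k := (intR (fun x => f x * rwavelet m l n k x) ^+ 2).

Let lm (l : 'I_m) : (0 < l.+1 <= m)%N. Proof. by rewrite ltn_ord. Qed.

Lemma frame_upper :
  (\esum_(j in [set: 'I_m * int * int]) (coef j.1.1.+1 j.1.2 j.2)%:E <=
  ((1 + err + frame_error) * energy)%:E)%E.
Proof.
rewrite (@esum_triple _ _ (fun l n k => (coef l.+1 n k)%:E)); last first.
  by move=> *; rewrite lee_fin sqr_ge0.
apply: esum_int_le => [n|N].
  by apply: sume_ge0 => l _; apply: esum_ge0 => k _; rewrite lee_fin sqr_ge0.
have i1 (l : 'I_m) n := integrable_symbol_term l n.
have i2 (l : 'I_m) n := integrable_term_error l n.
apply: (@le_trans _ _ (\sum_(i < N.*2) \sum_(l < m)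
    (avg (fun w => symbol_term m l.+1 (level (i%:Z - N%:Z) w)) +
     avg (term_error m l.+1 (i%:Z - N%:Z) e))%:E)%E).
  apply: lee_sum => i _; apply: lee_sum => l _.
  apply: esum_int_le => [k|K]; first by rewrite lee_fin sqr_ge0.
  by rewrite sumEFin lee_fin; exact: (scale_sum_le fi xfi _ (lm l) e0).
under eq_bigr do rewrite sumEFin.
rewrite sumEFin lee_fin.
have iS n : integrableR (fun w => (\sum_(l < m) (symbol_term m l.+1 (level n w) +
    term_error m l.+1 n e w)) * W w).
  apply: eq_integrableR (integrableR_sum (index_enum 'I_m)
    (fun l => integrableRD (i1 l n) (i2 l n))) => w.
  by rewrite mulr_suml; apply: eq_bigr => l _; rewrite mulrDl.
(* All averages are gathered into one, so that the sum over the scales can be bounded pointwise in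
   [w]. *)
under eq_bigr => i _.
  under eq_bigr => l _ do rewrite averageD//.
  rewrite average_sum; last first.
    by move=> l; apply: eq_integrableR (integrableRD (i1 l _) (i2 l _)) => w; rewrite mulrDl.
  over.
rewrite average_sum; last by move=> i; exact: iS.
rewrite -average_cst; apply: le_average.
- apply: eq_integrableR (integrableR_sum (index_enum 'I_N.*2) (fun i => iS (i%:Z - N%:Z))) => w.
  by rewrite mulr_suml.
- by apply: (@integrable_average _ `|1 + err + frame_error|).
move=> w; under eq_bigr do rewrite big_split /=.
rewrite big_split /= lerD ?sum_term_errors//.
rewrite sum_symbol_terms; have s0 : 0 <= N1 N w by exact: level_ge0.
have := symbol_telescope N.*2 m2 s0; rewrite ler_norml => /andP[_].
have : scale_main m (N1 N w) <= 1.
  by rewrite -[leRHS]expR0 ler_expR oppr_le0; apply: mulr_ge0 => //; exact: divr_ge0.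
have := expR_gt0 (- (m%:R / 3 * (4 ^+ N.*2 * N1 N w))).
rewrite -/(scale_main m _) -/err; lra.
Qed.

(** What telescoping leaves of the main term over the scales from -N to N - 1. *)
Let gap (N : nat) (w : R) : R :=
  scale_main m (N1 N w) - scale_main m (4 ^+ N.*2 * N1 N w).

Let gap_bound N w : `|gap N w| <= 1.
Proof.
have s0 : 0 <= N1 N w by exact: level_ge0.
have h (u : R) : 0 <= u -> 0 <= scale_main m u <= 1.
  move=> u0; apply/andP; split; first exact: expR_ge0.
  by rewrite -[leRHS]expR0 ler_expR oppr_le0; apply: mulr_ge0 => //; exact: divr_ge0.
have /andP[a1 a2] := h _ s0.
have /andP[b1 b2] := h _ (mulr_ge0 (exprn_ge0 N.*2 (ltac:(lra) : 0 <= 4 :> R)) s0).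
by rewrite /gap ler_norml; lra.
Qed.

Let measurable_gap N : measurable_fun setT (gap N).
Proof.
have ml := measurable_level (N%:Z - 1).
have ms : measurable_fun setT (@scale_main R m).
  by apply: measurableT_comp => //; apply: measurableT_comp => //; exact: measurable_funM.
apply: measurable_funB; first exact: (measurableT_comp ms ml).
by apply: (measurableT_comp ms); exact: measurable_funM.
Qed.

Let N1E (N : nat) w : N1 N w = w ^+ 2 / 4 * (4 ^+ N)^-1.
Proof.
rewrite /N1 /level expfzDr// exprMn.
have -> : (2 ^ N%:Z) ^+ 2 = 4 ^+ N :> R.
  by rewrite -exprM mulnC exprM; congr (_ ^+ N); ring.
have h : 0 < 4 ^+ N :> R by rewrite exprn_gt0.
rewrite (_ : 2 ^ (-1) = 2^-1 :> R)//.
by move: (4 ^+ N : R) h => q q0; field; rewrite gt_eqF.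
Qed.

(** With c = m w^2 / 12 the two exponents are c / 4^N and c 4^N, so the gap differs from 1 by
    O(1/N). At w = 0 it is always 0; this single point is a null set for the dominated convergence
    in [frame_lower]. *)
Let gap_cvg (w : R) : w != 0 -> gap N w @[N --> \oo] --> (1 : R).
Proof.
move=> w0; have [c c0 cE] : exists2 c, 0 < c & m%:R / 3 * (w ^+ 2 / 4) = c.
  exists (m%:R / 3 * (w ^+ 2 / 4)) => //.
  apply: mulr_gt0; apply: divr_gt0 => //; first by rewrite ltr0n; lia.
  by rewrite exprn_even_gt0.
have key (N : nat) : `|1 - gap N w| <= (c + c^-1) * N.+1%:R^-1.
  have h : N.+1%:R <= 4 ^+ N :> R by rewrite -natrX ler_nat ltn_expl.
  have h0 : 0 < N.+1%:R :> R by [].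
  have h4 := lt_le_trans h0 h.
  rewrite /gap /scale_main N1E.
  rewrite (_ : m%:R / 3 * (w ^+ 2 / 4 / 4 ^+ N) = c / 4 ^+ N); last by rewrite -cE mulrA.
  rewrite (_ : m%:R / 3 * (4 ^+ N.*2 * (w ^+ 2 / 4 / 4 ^+ N)) = c * 4 ^+ N); last first.
    rewrite -addnn exprD -cE; move: (4 ^+ N : R) h4 => q q0; field; by rewrite gt_eqF.
  have a1 := expR_ge1Dx (- (c / 4 ^+ N)).
  have a2 : expR (- (c / 4 ^+ N)) <= 1.
    by rewrite -[leRHS]expR0 ler_expR oppr_le0 divr_ge0// ltW.
  have b1 := expR_gt0 (- (c * 4 ^+ N)).
  have b2 : expR (- (c * 4 ^+ N)) <= c^-1 / N.+1%:R.
    rewrite expRN -invfM lef_pV2 ?posrE ?expR_gt0 ?mulr_gt0//.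
    apply: le_trans (expR_ge1Dx _); rewrite -[leLHS]add0r lerD//.
    by rewrite ler_wpM2l// ltW.
  have a3 : c / 4 ^+ N <= c / N.+1%:R by rewrite ler_wpM2l ?(ltW c0)// lef_pV2.
  rewrite mulrDl; move: a1 a2 a3 b1 b2; move: (c / _) (c^-1 / _) (c / _) (expR _) (expR _).
  by move=> u v x y z; rewrite ler_norml; lra.
apply/cvgrPdist_le => r r0.
have cv : (c + c^-1) * n.+1%:R^-1 @[n --> \oo] --> 0.
  by rewrite -[X in _ --> X](mulr0 (c + c^-1)); apply: cvgMr; exact: cvg_harmonic.
move/cvgr0Pnorm_le : cv => /(_ r r0); apply: filterS => n.
by apply: le_trans; rewrite (le_trans (key n))// ler_norm.
Qed.

Lemma frame_lower :
  (((1 - err - frame_error) * energy)%:E <=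
  \esum_(j in [set: 'I_m * int * int]) (coef j.1.1.+1 j.1.2 j.2)%:E)%E.
Proof.
rewrite (@esum_triple _ _ (fun l n k => (coef l.+1 n k)%:E)); last first.
  by move=> *; rewrite lee_fin sqr_ge0.
have [Wi WE] := spectrum_plancherel fM fi fc; have p0 := pi_gt0 R.
have i1 (l : 'I_m) n := integrable_symbol_term l n.
have i2 (l : 'I_m) n := integrable_term_error l n.
have igap N : integrableR (fun w => (gap N w - err - frame_error) * W w).
  apply: (@integrable_average _ (1 + `|err| + `|frame_error|)).
    by apply: measurable_funB => //; apply: measurable_funB.
  move=> w; rewrite (le_trans (ler_normB _ _))// lerD2r.
  by rewrite (le_trans (ler_normB _ _))// lerD2r gap_bound.
(* A finite window of scales bounds the full sum from below; the limit over the windows is taken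
   afterwards. *)
have bound N : ((avg (fun w => gap N w - err - frame_error))%:E <=
    \esum_(n in [set: int]) \sum_(l < m) \esum_(k in [set: int]) (coef l.+1 n k)%:E)%E.
  apply: (@le_trans _ _ (\sum_(i < N.*2) \sum_(l < m)
    \esum_(k in [set: int]) (coef l.+1 (i%:Z - N%:Z) k)%:E)%E); last first.
    apply: (@esum_int_ge _ (fun n => \sum_(l < m) \esum_(k in [set: int]) (coef l.+1 n k)%:E)%E).
    by move=> n; apply: sume_ge0 => l _; apply: esum_ge0 => k _; rewrite lee_fin sqr_ge0.
  apply: (@le_trans _ _ (\sum_(i < N.*2) \sum_(l < m)
    (avg (fun w => symbol_term m l.+1 (level (i%:Z - N%:Z) w)) -
     avg (term_error m l.+1 (i%:Z - N%:Z) e))%:E)%E); last first.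
    apply: lee_sum => i _; apply: lee_sum => l _.
    apply: lee_real_below => r hr.
    have [K HK] := scale_sum_ge fi xfi (lm l) e0 hr.
    apply: (@le_trans _ _ (\sum_(j < K.*2) (coef l.+1 (i%:Z - N%:Z) (j%:Z - K%:Z))%:E)%E).
      by rewrite sumEFin lee_fin ltW.
    apply: (@esum_int_ge _ (fun k => (coef l.+1 (i%:Z - N%:Z) k)%:E)) => k.
    by rewrite lee_fin sqr_ge0.
  under eq_bigr do rewrite sumEFin.
  rewrite sumEFin lee_fin.
  have iS n : integrableR (fun w => (\sum_(l < m) (symbol_term m l.+1 (level n w) -
      term_error m l.+1 n e w)) * W w).
    apply: eq_integrableR (integrableR_sum (index_enum 'I_m)
      (fun l => integrableRB (i1 l n) (i2 l n))) => w.
    by rewrite mulr_suml; apply: eq_bigr => l _; rewrite mulrBl.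
  under eq_bigr => i _.
    under eq_bigr => l _ do rewrite averageB//.
    rewrite average_sum; last first.
      by move=> l; apply: eq_integrableR (integrableRB (i1 l _) (i2 l _)) => w; rewrite mulrBl.
    over.
  rewrite average_sum; last by move=> i; exact: iS.
  apply: le_average => //.
    apply: eq_integrableR (integrableR_sum (index_enum 'I_N.*2) (fun i => iS (i%:Z - N%:Z))) => w.
    by rewrite mulr_suml.
  move=> w; under eq_bigr do rewrite sumrB /=.
  rewrite sumrB lerB ?sum_term_errors//.
  rewrite sum_symbol_terms; have s0 : 0 <= N1 N w by exact: level_ge0.
  have := symbol_telescope N.*2 m2 s0; rewrite ler_norml => /andP[+ _].
  by rewrite -/err /gap; lra.
apply: lee_real_below => r hr.
have [|||||_ cv] := @intR_dominated _ (fun N w => gap N w * W w) W W.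
- by move=> N; apply: measurable_funM => //; exact: integrableR_meas Wi.
- exact: integrableR_meas Wi.
- exists [set 0]; split; [exact: measurable_set1|exact: lebesgue_measure_set1|].
  move=> w /=; apply: contra_notP => /eqP w0.
  by rewrite -[X in _ --> X]mul1r; apply: cvgMl; exact: gap_cvg.
- exact: Wi.
- move=> N w; rewrite normrM (ger0_norm (spectrum_ge0 _ _)) ler_piMl ?spectrum_ge0//.
have avgE N : avg (fun w => gap N w - err - frame_error) =
    pi^-1 * intR (fun w => gap N w * W w) - (err + frame_error) * energy.
  rewrite -average_cst /average -mulrBr -intRB.
  - by congr (_ * _); apply: eq_intR => w; ring.
  - exact: (@integrable_average _ 1).
  - exact: integrableRZ.
have cv' : avg (fun w => gap N w - err - frame_error) @[N --> \oo] -->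
    (1 - err - frame_error) * energy.
  under eq_fun do rewrite avgE.
  rewrite (_ : (1 - err - frame_error) * energy =
    pi^-1 * intR W - (err + frame_error) * energy); last first.
    by rewrite WE mulKf ?gt_eqF//; ring.
  by apply: cvgB; [apply: cvgMr|exact: cvg_cst].
have /cvgrPdist_lt/(_ ((1 - err - frame_error) * energy - r)) := cv'.
rewrite subr_gt0 => /(_ hr)[N _ /(_ N (leqnn _))] /= H.
apply: le_trans (bound N); rewrite lee_fin.
by move: H; rewrite ltr_norml; lra.
Qed.

End FixedOrder.
End NiceFrame.

(** * Passing to the closure in L2 *)

Lemma le_limits {R : realType} (u v : nat -> R) (a b : R) :
  u n @[n --> \oo] --> a -> v n @[n --> \oo] --> b -> (forall n, u n <= v n) -> a <= b.
Proof.
move=> ua vb uv; rewrite -(cvg_lim _ ua)// -(cvg_lim _ vb)//.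
by apply: ler_lim; [apply/cvg_ex; exists a|apply/cvg_ex; exists b|exact: nearW].
Qed.

Local Notation elems X := (finmap.enum_fset (fset_set X)).

Section SquareIntegrable.
Context {R : realType}.
Local Notation mu := (@lebesgue_measure R).
Implicit Types (f g w : R -> R).

Definition sqr_integrable f : Prop :=
  measurable_fun setT f /\ integrableR (fun x => f x ^+ 2).

Lemma sqr_integrableM f g : sqr_integrable f -> sqr_integrable g ->
  integrableR (fun x => f x * g x).
Proof.
move=> [mf f2] [mg g2]; apply: (@le_integrableR _ _ (fun x => f x ^+ 2 + g x ^+ 2)).
- exact: measurable_funM.
- move=> x; rewrite ler_norml; have := sqr_ge0 (f x + g x); have := sqr_ge0 (f x - g x).
  have := sqr_ge0 (f x); have := sqr_ge0 (g x); nra.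
- exact: integrableRD.
Qed.

Lemma sqr_integrableB f g : sqr_integrable f -> sqr_integrable g ->
  sqr_integrable (fun x => f x - g x).
Proof.
move=> L2f L2g; have [mf f2] := L2f; have [mg g2] := L2g; split.
  exact: measurable_funB.
apply: eq_integrableR (integrableRB (integrableRD f2 g2)
  (integrableRZ 2 (sqr_integrableM L2f L2g))).
by move=> x; ring.
Qed.

(** A weighted arithmetic-geometric mean inequality doing the work of Cauchy-Schwarz; [cvg_intR_mul]
    tunes the free parameter [e]. *)
Lemma le_intR_mul f g (e : R) : sqr_integrable f -> sqr_integrable g -> 0 < e ->
  `|intR (fun x => f x * g x)| <=
  intR (fun x => f x ^+ 2) / e + e * intR (fun x => g x ^+ 2).
Proof.
move=> L2f L2g e0; have fg := sqr_integrableM L2f L2g.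
have [_ f2] := L2f; have [_ g2] := L2g.
apply: le_trans (le_norm_intR fg) _.
rewrite mulrC -!intRZ// -intRD; [|exact: integrableRZ|exact: integrableRZ].
apply: le_intR; [exact: integrableR_norm|by apply: integrableRD; exact: integrableRZ|].
move=> x; rewrite -(ler_pM2l e0) mulrDr mulVKf ?gt_eqF//.
rewrite (_ : e * (e * g x ^+ 2) = (e * g x) ^+ 2); last by ring.
have h1 := sqr_ge0 (f x + e * g x); have h2 := sqr_ge0 (f x - e * g x).
have h3 := sqr_ge0 (f x); have h4 := sqr_ge0 (e * g x).
by case: (ger0P (f x * g x)) => _; nra.
Qed.

Section Limit.
Variables (f : R -> R) (g : nat -> R -> R).
Hypotheses (L2f : sqr_integrable f) (L2g : forall n, sqr_integrable (g n)).
Hypothesis gf : intR (fun x => (f x - g n x) ^+ 2) @[n --> \oo] --> (0 : R).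

Lemma cvg_intR_mul w : sqr_integrable w ->
  intR (fun x => g n x * w x) @[n --> \oo] --> intR (fun x => f x * w x).
Proof.
move=> L2w; apply/cvgrPdist_le => r r0.
pose w2 := intR (fun x => w x ^+ 2).
have w20 : 0 <= w2 by apply: intR_ge0 => x; exact: sqr_ge0.
(* Keeps [e * w2] at most [r / 2]; the added 1 allows [w2 = 0]. *)
pose e := r / (2 * (w2 + 1)).
have e0 : 0 < e by rewrite divr_gt0// mulr_gt0//; lra.
have re0 : 0 < e * (r / 2) by rewrite mulr_gt0// divr_gt0.
move/cvgrPdist_le : gf => /(_ _ re0); apply: filterS => n.
rewrite sub0r normrN ger0_norm; last by apply: intR_ge0 => x; exact: sqr_ge0.
move=> H; rewrite -intRB; [|exact: sqr_integrableM|exact: sqr_integrableM].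
have -> : intR (fun x => f x * w x - g n x * w x) = intR (fun x => (f x - g n x) * w x).
  by apply: eq_intR => x; ring.
apply: le_trans (le_intR_mul (sqr_integrableB L2f (L2g n)) L2w e0) _.
rewrite [leRHS]splitr lerD//; first by rewrite ler_pdivrMr// mulrC.
by rewrite -/w2 /e mulrAC ler_pdivrMr ?mulr_gt0//; nra.
Qed.

Lemma cvg_intR_sqr :
  intR (fun x => g n x ^+ 2) @[n --> \oo] --> intR (fun x => f x ^+ 2).
Proof.
have E n : intR (fun x => g n x ^+ 2) =
    intR (fun x => (f x - g n x) ^+ 2) +
    (2 * intR (fun x => g n x * f x) - intR (fun x => f x ^+ 2)).
  have [_ d2] := sqr_integrableB L2f (L2g n); have [_ f2] := L2f.
  have fg := sqr_integrableM (L2g n) L2f.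
  rewrite -intRZ// -intRB//; last exact: integrableRZ.
  rewrite -intRD//; last by apply: integrableRB => //; exact: integrableRZ.
  by apply: eq_intR => x; ring.
have lim0 : 0 + (2 * intR (fun x => f x * f x) - intR (fun x => f x ^+ 2)) =
    intR (fun x => f x ^+ 2).
  by rewrite -(eq_intR (fun x => expr2 (f x))); ring.
rewrite -lim0; under eq_fun do rewrite E.
apply: cvgD; first exact: gf.
by apply: cvgB; [apply: cvgMr; exact: (cvg_intR_mul L2f)|exact: cvg_cst].
Qed.

Section Frame.
Variables (J : choiceType) (w : J -> R -> R).
Hypothesis L2w : forall j, sqr_integrable (w j).

Definition frame_sum (h : R -> R) : \bar R :=
  (\esum_(j in [set: J]) (intR (fun x => h x * w j x) ^+ 2)%:E)%E.

Lemma fsum_frame_sum (X : set J) (h : R -> R) : finite_set X ->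
  ((\sum_(j <- elems X) intR (fun x => h x * w j x) ^+ 2)%:E <= frame_sum h)%E.
Proof.
move=> Xfin; apply: esum_ge; exists X; first by split.
by rewrite fsbig_finite//= sumEFin.
Qed.

Lemma frame_sum_le (h : R -> R) (C : \bar R) :
  (forall X : set J, finite_set X ->
    ((\sum_(j <- elems X) intR (fun x => h x * w j x) ^+ 2)%:E <= C)%E) ->
  (frame_sum h <= C)%E.
Proof.
move=> H; apply: ge_ereal_sup => _ [X [Xfin _] <-].
by rewrite fsbig_finite//= sumEFin; exact: H.
Qed.

(** As in Fatou's lemma: each finite partial sum converges along the approximation, and the bound
    passes to the supremum. *)
Lemma frame_upper_closure (B : R) :
  (forall n, (frame_sum (g n) <= (B * intR (fun x => g n x ^+ 2))%:E)%E) ->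
  (frame_sum f <= (B * intR (fun x => f x ^+ 2))%:E)%E.
Proof.
move=> HB; apply: frame_sum_le => X Xfin; rewrite lee_fin.
apply: (@le_limits _ (fun n => \sum_(j <- elems X) intR (fun x => g n x * w j x) ^+ 2)
   (fun n => B * intR (fun x => g n x ^+ 2))).
- elim: (finmap.enum_fset _) => [|j s IH].
    by under eq_fun do rewrite big_nil; rewrite big_nil; exact: cvg_cst.
  under eq_fun do rewrite big_cons; rewrite big_cons; apply: cvgD => //.
  by under eq_fun do rewrite expr2; rewrite expr2; apply: cvgM; exact: cvg_intR_mul.
- by apply: cvgMr; exact: cvg_intR_sqr.
- move=> n; rewrite -lee_fin; apply: le_trans (HB n).
  exact: fsum_frame_sum.
Qed.

(** Convergence of finite partial sums alone does not transfer a lower bound, so the upper bound for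
    [f - g n] is used to compare the frame sums of [g n] and [f], through (a - b)^2 <= (1 + e) a^2 +
    (1 + 1/e) b^2. First [n] tends to infinity, then [e] becomes small. *)
Lemma frame_lower_closure (A B : R) :
  (frame_sum f \is a fin_num) ->
  (forall n, ((A * intR (fun x => g n x ^+ 2))%:E <= frame_sum (g n))%E) ->
  (forall n, (frame_sum (fun x => f x - g n x)%R <=
    (B * intR (fun x => (f x - g n x) ^+ 2))%:E)%E) ->
  ((A * intR (fun x => f x ^+ 2))%:E <= frame_sum f)%E.
Proof.
move=> ffin HA HB; rewrite -(fineK ffin) lee_fin.
set q := fine _; have qE : frame_sum f = q%:E by rewrite fineK.
have q0 : 0 <= q by rewrite -lee_fin -qE; apply: esum_ge0 => j _; rewrite lee_fin sqr_ge0.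
have key e : 0 < e -> A * intR (fun x => f x ^+ 2) <= (1 + e) * q.
  move=> e0; pose d n := intR (fun x => (f x - g n x) ^+ 2).
  have H n : A * intR (fun x => g n x ^+ 2) <= (1 + e) * q + (1 + e^-1) * (B * d n).
    rewrite -lee_fin; apply: le_trans (HA n) _; apply: frame_sum_le => X Xfin.
    rewrite lee_fin.
    have s1 : \sum_(j <- elems X) intR (fun x => f x * w j x) ^+ 2 <= q.
      by rewrite -lee_fin -qE; exact: fsum_frame_sum.
    have s2 : \sum_(j <- elems X) intR (fun x => (f x - g n x) * w j x) ^+ 2 <=
        B * d n.
      by rewrite -lee_fin; apply: le_trans (HB n); exact: fsum_frame_sum.
    apply: (@le_trans _ _ (\sum_(j <- elems X) ((1 + e) * intR (fun x => f x * w j x) ^+ 2 +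
      (1 + e^-1) * intR (fun x => (f x - g n x) * w j x) ^+ 2))).
      apply: ler_sum => j _.
      have -> : intR (fun x => g n x * w j x) =
          intR (fun x => f x * w j x) - intR (fun x => (f x - g n x) * w j x).
        rewrite -intRB; [|exact: sqr_integrableM|].
          by apply: eq_intR => x; ring.
        by apply: sqr_integrableM => //; exact: sqr_integrableB.
      set a := intR _; set b := intR _.
      rewrite -subr_ge0.
      have -> : (1 + e) * a ^+ 2 + (1 + e^-1) * b ^+ 2 - (a - b) ^+ 2 =
          e^-1 * (e * a + b) ^+ 2 by field; rewrite gt_eqF.
      by rewrite mulr_ge0 ?sqr_ge0// invr_ge0 ltW.
    rewrite big_split -!mulr_sumr /= lerD// ler_wpM2l//; first lra.
    by rewrite addr_ge0// invr_ge0 ltW.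
  apply: (@le_limits _ (fun n => A * intR (fun x => g n x ^+ 2))
     (fun n => (1 + e) * q + (1 + e^-1) * (B * d n))).
  - by apply: cvgMr; exact: cvg_intR_sqr.
  - rewrite -[X in _ --> X]addr0; apply: cvgD; first exact: cvg_cst.
    rewrite -(mulr0 (1 + e^-1)); apply: cvgMr.
    by rewrite -(mulr0 B); apply: cvgMr.
  - exact: H.
rewrite leNgt; apply/negP => lt.
pose D := A * intR (fun x => f x ^+ 2) - q.
have D0 : 0 < D by rewrite subr_gt0.
(* For this value of [e] the surplus [e * q] is at most half of the supposed excess [D]. *)
have := key (D / (2 * (q + 1))); rewrite divr_gt0 ?mulr_gt0//; last by lra.
move=> /(_ isT); have : D / (2 * (q + 1)) * q <= D / 2.
  rewrite mulrAC ler_pdivrMr ?mulr_gt0//; last by lra.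
  nra.
rewrite /D in D0 *; lra.
Qed.

End Frame.
End Limit.
End SquareIntegrable.

(** * Density of the test functions in L2 *)

Section Density.
Context {R : realType}.
Local Notation mu := (@lebesgue_measure R).
Implicit Types (f g h : R -> R) (c x y z : R).

(** For nonnegative [c], truncation of [y] to [-c, c], in a form that is visibly continuous. *)
Definition clip c y : R := (`|y + c| - `|y - c|) / 2.

Lemma clip_bound c y : 0 <= c -> `|clip c y| <= c.
Proof.
move=> c0; rewrite /clip ler_norml; case: (ger0P (y + c)); case: (ger0P (y - c)); lra.
Qed.

Lemma clip_id c y : `|y| <= c -> clip c y = y.
Proof.
rewrite /clip ler_norml => /andP[y1 y2].
by rewrite ger0_norm ?ler0_norm; lra.
Qed.

Lemma clip_lipschitz c y z : 0 <= c -> `|clip c y - clip c z| <= `|y - z|.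
Proof.
move=> c0; rewrite /clip; case: (ger0P (y - z)) => ?; rewrite ler_norml;
case: (ger0P (y + c)) => ?; case: (ger0P (y - c)) => ?;
case: (ger0P (z + c)) => ?; case: (ger0P (z - c)) => ?; lra.
Qed.

Lemma clip_diff c y : 0 <= c -> `|y - clip c y| <= `|y|.
Proof.
move=> c0; rewrite /clip; case: (ger0P y) => ?; rewrite ler_norml;
case: (ger0P (y + c)) => ?; case: (ger0P (y - c)) => ?; lra.
Qed.

Lemma continuous_clip c : continuous (clip c).
Proof.
move=> y; apply: cvgM; last exact: cvg_cst.
apply: cvgB; apply: cvg_norm; last by apply: cvgB; [exact: cvg_id|exact: cvg_cst].
by apply: cvgD; [exact: cvg_id|exact: cvg_cst].
Qed.

Definition window c g x : R := clip c (g x) * \1_(`[- c, c] : set R) x.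

Lemma window_itv c g x : window c g x = if `|x| <= c then clip c (g x) else 0.
Proof.
rewrite /window indicE mem_setE in_itv/= -ler_norml.
by case: ifP => _; rewrite ?mulr1 ?mulr0.
Qed.

Lemma measurable_window c g : measurable_fun setT g -> measurable_fun setT (window c g).
Proof.
move=> mg; apply: measurable_funM; last exact: measurable_indic.
exact: (measurableT_comp (continuous_measurable_fun (@continuous_clip c)) mg).
Qed.

(** The hypotheses of the frame bounds for test functions; integrability of [x * g x] makes the
    transform of [g] differentiable. *)
Definition admissible g : Prop := exists M : R,
  [/\ forall x, `|g x| <= M, integrableR g, integrableR (fun x => x * g x) &
      {ae mu, forall x, {for x, continuous g}}].

Lemma integrable_window_bound c M g : 0 <= c -> measurable_fun setT g ->
  (forall x, `|g x| <= M * \1_(`[- c, c] : set R) x) -> integrableR g.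
Proof.
move=> c0 mg gM; apply: (@le_integrableR _ _ (fun x => M * \1_(`[- c, c] : set R) x)) => //.
apply: integrableRZ; exact: (@integrable_indic_itv R (- c) c true false).
Qed.

(** Jumps can occur only at the two end points [- c] and [c]. *)
Lemma window_admissible c g : 0 <= c -> continuous g -> admissible (window c g).
Proof.
move=> c0 cg; have mw := measurable_window c (continuous_measurable_fun cg).
have wb x : `|window c g x| <= c * \1_(`[- c, c] : set R) x.
  rewrite /window normrM ler_pM// ?clip_bound// indicE.
  by case: (x \in _); rewrite ?normr1 ?normr0.
exists c; split.
- move=> x; apply: le_trans (wb x) _; rewrite ler_piMr// indicE.
- exact: (integrable_window_bound c0 mw wb).
- apply: (@integrable_window_bound c (c * c)) => //; first exact: measurable_funM.
  move=> x; rewrite window_itv indicE mem_setE in_itv/= -ler_norml.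
  case: ifP => xc; last by rewrite !mulr0 normr0.
  by rewrite mulr1 normrM ler_pM// clip_bound.
- exists [set - c; c]; split.
  + exact: measurableU.
  + by rewrite null_set_setU//; exact: lebesgue_measure_set1.
  move=> x /=; apply: contra_notP => /not_orP[xN xP].
  have [xc|xc] := ltP `|x| c.
    rewrite /prop_for /continuous_at window_itv (ltW xc).
    apply: cvg_trans (_ : clip c (g y) @[y --> x] --> clip c (g x)); last first.
      exact: (continuous_comp (cg x) (@continuous_clip c (g x))).
    apply: near_eq_cvg; near=> y; rewrite window_itv ifT//; apply: ltW; near: y.
    by apply: (cvgr_lt `|x|) => //; apply: cvg_norm; exact: cvg_id.
  have {}xc : c < `|x|.
    rewrite lt_neqAle xc andbT; apply/eqP => cx; move: xN xP; rewrite cx.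
    by case: (ger0P x) => _; rewrite ?opprK.
  rewrite /prop_for /continuous_at window_itv leNgt xc /=.
  apply: cvg_trans (_ : 0 @[y --> x] --> (0 : R)); last exact: cvg_cst.
  apply: near_eq_cvg; near=> y; rewrite window_itv ifF//; apply/negbTE; rewrite -ltNge.
  near: y; by apply: (cvgr_gt `|x|) => //; apply: cvg_norm; exact: cvg_id.
Unshelve. all: by end_near. Qed.

Lemma window_sqr_integrable c g : 0 <= c -> measurable_fun setT g ->
  sqr_integrable (window c g).
Proof.
move=> c0 mg; have mw := measurable_window c mg; split => //.
apply: (@integrable_window_bound c (c * c)) => //; first exact: measurable_funX.
move=> x; rewrite window_itv indicE mem_setE in_itv/= -ler_norml.
case: ifP => xc; last by rewrite expr0n /= normr0 mulr0.
by rewrite mulr1 expr2 normrM ler_pM// clip_bound.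
Qed.

(** Continuous functions approximate the clipped function in L1 on the bounded interval. Clipping is
    1-Lipschitz and keeps differences within [2 * c], so the squared L2 error is at most [2 * c]
    times the L1 error. *)
Lemma window_approx c f (r : R) : 0 <= c -> measurable_fun setT f -> 0 < r ->
  exists g, continuous g /\ intR (fun x => (window c f x - window c g x) ^+ 2) <= r.
Proof.
move=> c0 mf r0; pose E : set R := `[- c, c]%classic.
pose F x := clip c (f x).
have mF : measurable_fun setT F.
  exact: (measurableT_comp (continuous_measurable_fun (@continuous_clip c)) mf).
have mE : measurable E by exact: measurable_itv.
have finE : (mu E < +oo)%E by rewrite lebesgue_measure_itv; case: ifP => _; rewrite ltry.
have onE (G : R -> R) : mu.-integrable E (EFin \o G) -> integrableR (fun x => G x * \1_E x).
  move=> iG; have H := proj1 (@integrable_mkcond _ _ _ mu E (EFin \o G) mE) iG.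
  apply: eq_integrable H => // x _.
  by rewrite /= patchE indicE; case: ifP => _; rewrite ?mulr1 ?mulr0.
have FE : mu.-integrable E (EFin \o F).
  apply: measurable_bounded_integrable => //; first exact: measurable_funTS.
  exists c; split; rewrite ?num_real// => y cy x _ /=.
  by rewrite (le_trans (clip_bound (f x) c0))// ltW.
have [h [ch hi hF]] := approximation_continuous_integrable mE finE FE.
pose e := r / (2 * c + 1).
have e0 : 0 < e by rewrite divr_gt0//; lra.
have int1 n : integrableR (fun x => `|F x - h n x| * \1_E x).
  apply: eq_integrableR (integrableR_norm (integrableRB (onE F FE) (onE (h n) (hi n)))) => x.
  by rewrite -mulrBl normrM indicE; case: (x \in E); rewrite ?normr1 ?normr0.
have intE n : (\int[mu]_(z in E) `|(F z - h n z)%:E|)%E =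
    (intR (fun x => `|F x - h n x| * \1_E x))%:E.
  rewrite -intRE// integral_mkcond; apply: eq_integral => x _.
  by rewrite patchE indicE; case: ifP => _; rewrite ?mulr1 ?mulr0.
have cvE : intR (fun x => `|F x - h n x| * \1_E x) @[n --> \oo] --> 0.
  have : (intR (fun x => `|F x - h n x| * \1_E x))%:E @[n --> \oo] --> 0%:E.
    by under eq_fun do rewrite -intE.
  by move/fine_cvg.
have /cvgr0Pnorm_le/(_ _ e0)[n _ /(_ n (leqnn _)) /= Hn] := cvE.
exists (h n); split; first exact: ch.
have [mw1 w1] := sqr_integrableB (window_sqr_integrable c0 mf)
  (window_sqr_integrable c0 (continuous_measurable_fun (ch n))).
apply: (@le_trans _ _ (2 * c * e)); last first.
  by rewrite /e mulrCA ler_piMr ?(ltW r0)// ler_pdivrMr; lra.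
apply: (@le_trans _ _ (2 * c * intR (fun x => `|F x - h n x| * \1_E x))); last first.
  by rewrite ler_wpM2l ?mulr_ge0// (le_trans (ler_norm _)).
rewrite -intRZ//; apply: le_intR => //; first exact: integrableRZ.
move=> x; rewrite /window -/E -mulrBl indicE.
case: (x \in E); rewrite ?mulr0 ?expr0n//= !mulr1 -/(F x).
have FF : F x = clip c (F x) by rewrite clip_id// clip_bound.
have d1 := clip_lipschitz (F x) (h n x) c0; rewrite -FF in d1.
have d2 : `|F x - clip c (h n x)| <= 2 * c.
  apply: le_trans (ler_normB _ _) _.
  by have := clip_bound (f x) c0; have := clip_bound (h n x) c0; rewrite -/(F x); lra.
by rewrite -real_normK ?num_real// expr2 ler_pM.
Qed.

Lemma window_cvg f : sqr_integrable f ->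
  intR (fun x => (f x - window n%:R f x) ^+ 2) @[n --> \oo] --> (0 : R).
Proof.
move=> [mf f2].
have [|||||_] := @intR_dominated _ (fun n x => (f x - window n%:R f x) ^+ 2)
  (fun=> 0) (fun x => f x ^+ 2).
- by move=> n; apply: measurable_funX; apply: measurable_funB => //; exact: measurable_window.
- exact: measurable_cst.
- apply: aeW => x; apply: cvg_near_cst; near=> n.
  have n1 : `|x| <= n%:R by near: n; exact: nbhs_infty_ger.
  have n2 : `|f x| <= n%:R by near: n; exact: nbhs_infty_ger.
  by rewrite window_itv n1 clip_id// subrr expr0n.
- exact: f2.
- move=> n x; rewrite normrX -[leRHS]real_normK ?num_real// lerXn2r ?nnegrE//.
  by rewrite window_itv; case: ifP => _; rewrite ?subr0// clip_diff.
by rewrite intR0.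
Unshelve. all: by end_near. Qed.

Lemma admissible_dense f : sqr_integrable f -> exists g : nat -> R -> R,
  [/\ forall n, admissible (g n), forall n, sqr_integrable (g n) &
      intR (fun x => (f x - g n x) ^+ 2) @[n --> \oo] --> (0 : R)].
Proof.
move=> L2f; have [mf f2] := L2f.
have n0 n : 0 <= n%:R :> R by [].
have r0 n : 0 < n.+1%:R^-1 :> R by [].
pose h n := projT1 (cid (window_approx (n0 n) mf (r0 n))).
have hP n : continuous (h n) /\
    intR (fun x => (window n%:R f x - window n%:R (h n) x) ^+ 2) <= n.+1%:R^-1.
  exact: projT2 (cid (window_approx (n0 n) mf (r0 n))).
have L2w n : sqr_integrable (window n%:R (h n)).
  by apply: window_sqr_integrable => //; apply: continuous_measurable_fun; have [] := hP n.
exists (fun n => window n%:R (h n)); split => //.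
  by move=> n; apply: window_admissible => //; have [] := hP n.
have L2wf n : sqr_integrable (window n%:R f) by exact: window_sqr_integrable.
have key n : intR (fun x => (f x - window n%:R (h n) x) ^+ 2) <=
    2 * intR (fun x => (f x - window n%:R f x) ^+ 2) + 2 * n.+1%:R^-1.
  have [_ i1] := sqr_integrableB L2f (L2w n).
  have [_ i2] := sqr_integrableB L2f (L2wf n).
  have [_ i3] := sqr_integrableB (L2wf n) (L2w n).
  have [_ hn] := hP n.
  apply: (@le_trans _ _ (2 * intR (fun x => (f x - window n%:R f x) ^+ 2) +
    2 * intR (fun x => (window n%:R f x - window n%:R (h n) x) ^+ 2))); last first.
    by rewrite lerD2l ler_wpM2l.
  rewrite -!intRZ// -intRD; [|exact: integrableRZ|exact: integrableRZ].
  apply: le_intR => //; first by apply: integrableRD; exact: integrableRZ.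
  move=> x; set a := f x; set b := window _ f x; set c := window _ _ x.
  by have := sqr_ge0 (a - b - (b - c)); nra.
have cv : 2 * intR (fun x => (f x - window n%:R f x) ^+ 2) + 2 * n.+1%:R^-1
    @[n --> \oo] --> (0 : R).
  rewrite -[X in _ --> X](_ : 2 * 0 + 2 * 0 = _); last by ring.
  by apply: cvgD; apply: cvgMr; [exact: window_cvg|exact: cvg_harmonic].
apply/cvgr0Pnorm_le => r rr.
move/cvgr0Pnorm_le : cv => /(_ r rr); apply: filterS => n.
apply: le_trans; rewrite ger0_norm; last by apply: intR_ge0 => x; exact: sqr_ge0.
exact: le_trans (key n) (ler_norm _).
Qed.

End Density.

(** * The Gaussian wavelet frame *)

Section RealFrame.
Context {R : realType}.
Local Notation mu := (@lebesgue_measure R).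

(** The wavelet is a multiple of the transform of a bounded, continuous, integrable function, so
    Plancherel's formula makes its square integrable. *)
Lemma sqr_integrable_rwavelet m l (n k : int) : (0 < l <= m)%N ->
  sqr_integrable (@rwavelet R m l n k).
Proof.
move=> lm; have s0 := @scaled_width_gt0 R m l n lm.
pose b (z : R) := z ^+ l * gauss (scaled_width m l n) z * cos (z * node m n k + phase l).
have bi : integrableR b by apply: integrable_cosT; exact: integrable_pow_gauss.
have [C C0 HC] := pow_gauss_bounded l s0.
have bC z : `|b z| <= C.
  rewrite /b normrM -[leRHS]mulr1 ler_pM//; exact: cos_max.
have bc : {ae mu, forall z, {for z, continuous b}}.
  apply: aeW => z; apply: cvgM; last exact: continuous_cos_affine.
  by apply: cvgM; [exact: exprn_continuous|exact: continuous_gauss].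
have [b2 _] := cosT_plancherel cos_2pi4 bi bC bc.
rewrite (_ : @rwavelet R m l n k = fun x => wavelet_scale m l n * cosT (pi / 4) b x); last first.
  by apply/funext => x; rewrite rwavelet_cosT.
split; first by apply: measurable_funM => //; exact: measurable_cosT.
by apply: eq_integrableR (integrableRZ (wavelet_scale m l n ^+ 2) b2) => x; rewrite [RHS]exprMn.
Qed.

Variables (m : nat) (e : R).
Hypotheses (m2 : (2 <= m)%N) (e0 : 0 < e).

Definition lower_bound : R := 1 - scale_error m - frame_error m e.
Definition upper_bound : R := 1 + scale_error m + frame_error m e.

Definition index_wavelet (j : 'I_m * int * int) : R -> R :=
  rwavelet m j.1.1.+1 j.1.2 j.2.

Lemma sqr_integrable_index_wavelet j : sqr_integrable (index_wavelet j).
Proof. by apply: sqr_integrable_rwavelet; rewrite ltn_ord. Qed.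

Lemma real_frame_upper (f : R -> R) : sqr_integrable f ->
  (frame_sum index_wavelet f <= (upper_bound * intR (fun x => f x ^+ 2))%:E)%E.
Proof.
move=> L2f; have [g [gadm L2g gf]] := admissible_dense L2f.
apply: (frame_upper_closure L2f L2g gf sqr_integrable_index_wavelet) => n.
have [M [gM gi xgi gc]] := gadm n.
exact: (frame_upper gM gi xgi gc m2 e0).
Qed.

Lemma real_frame_lower (f : R -> R) : sqr_integrable f ->
  ((lower_bound * intR (fun x => f x ^+ 2))%:E <= frame_sum index_wavelet f)%E.
Proof.
move=> L2f; have [g [gadm L2g gf]] := admissible_dense L2f.
apply: (frame_lower_closure (B := upper_bound) L2f L2g gf sqr_integrable_index_wavelet).
- rewrite ge0_fin_numE; last by apply: esum_ge0 => j _; rewrite lee_fin sqr_ge0.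
  by apply: le_lt_trans (real_frame_upper L2f) _; rewrite ltry.
- move=> n; have [M [gM gi xgi gc]] := gadm n.
  exact: (frame_lower gM gi xgi gc m2 e0).
- by move=> n; apply: real_frame_upper; exact: sqr_integrableB.
Qed.

End RealFrame.

(** * From real to complex signals *)

Section ComplexFrame.
Context {R : realType}.
Local Notation mu := (@lebesgue_measure R).

Lemma sqr_integrable_Lfun (f : R -> R) :
  f \in Lfun mu 2%:E <-> sqr_integrable f.
Proof.
split=> [Lf|[mf f2]].
  split; last exact: (Lfun2_integrable_sqr Lf).
  by move: Lf; rewrite inE => /andP[]; rewrite inE.
rewrite inE; apply/andP; split; rewrite inE//=.
rewrite /finite_norm unlock /= poweR_lty//.
under eq_integral => x _ do rewrite powR_mulrn// -normrX ger0_norm ?sqr_ge0//.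
by rewrite intRE// ltry.
Qed.

Lemma normcE (a b : R) : normc (a +i* b)%C ^+ 2 = a ^+ 2 + b ^+ 2.
Proof. by rewrite /normc sqr_sqrtr// addr_ge0 ?sqr_ge0. Qed.

Lemma poweR2 (y : \bar R) : (0 <= y)%E -> (y `^ 2 = y ^+ 2)%E.
Proof.
case: y => [y y0| _|//]; first by rewrite poweR_EFin powR_mulrn.
by rewrite poweRyr// expe2 mulyy.
Qed.

Lemma L2_norm_sqr (f : R -> R[i]) :
  sqr_integrable (fun x => complex.Re (f x)) ->
  sqr_integrable (fun x => complex.Im (f x)) ->
  (L2_norm f ^+ 2)%E = (intR (fun x => complex.Re (f x) ^+ 2) +
                    intR (fun x => complex.Im (f x) ^+ 2))%:E.
Proof.
move=> [mu_ u2] [mv v2].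
have := @powR_Lnorm _ _ R mu (fun x => (normc (f x))%:E) 2 (ltac:(by [])).
rewrite /L2_norm => H; rewrite -intRD// -intRE; last exact: integrableRD.
transitivity ('N[mu]_2%:E[(fun x => (normc (f x))%:E)] `^ 2)%E.
  by rewrite poweR2// Lnorm_ge0.
rewrite H; apply: eq_integral => x _ /=.
by rewrite powR_mulrn// -normrX ger0_norm ?sqr_ge0//; case: (f x) => a b; rewrite normcE.
Qed.

Lemma wavelet_systemE m (l : 'I_m) (n k : int) x :
  wavelet_system (@Gsystem R m) (l, n, k) x = ((rwavelet m l.+1 n k x)%:C)%C.
Proof. by rewrite /wavelet_system /Gsystem /rwavelet -rmorphM. Qed.

Lemma L2_inner_real (f : R -> R[i]) (w : R -> R) (F : R -> R[i]) :
  (forall x, F x = ((w x)%:C)%C) ->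
  normc (L2_inner f F) ^+ 2 =
  intR (fun x => complex.Re (f x) * w x) ^+ 2 + intR (fun x => complex.Im (f x) * w x) ^+ 2.
Proof.
move=> FE; rewrite normcE; congr (_ ^+ 2 + _ ^+ 2); apply: eq_intR => x; rewrite FE.
  by case: (f x) => a b /=; ring.
by case: (f x) => a b /=; ring.
Qed.

(** The wavelets are real, so the squared norm and the frame sum both split over the real and
    imaginary parts of the signal, and the real bounds carry over unchanged. *)
Lemma gaussian_frame m (e : R) : (2 <= m)%N -> 0 < e -> 0 < lower_bound m e ->
  is_frame (wavelet_system (@Gsystem R m)) (lower_bound m e) (upper_bound m e).
Proof.
move=> m2 e0 A0; split => //.
- rewrite /lower_bound /upper_bound.
  have h1 := scale_error_ge0 m : 0 <= scale_error m :> R.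
  have h2 : 0 <= frame_error m e.
    apply: addr_ge0; first by apply: mulr_ge0; [exact: ltW|exact: addr_ge0].
    by apply: divr_ge0; [exact: mulr_ge0|exact: ltW].
  lra.
- move=> [[l n] k].
  have [mw w2] := @sqr_integrable_rwavelet R m l.+1 n k (ltac:(by rewrite ltn_ord)).
  split; apply/sqr_integrable_Lfun.
    rewrite (_ : (fun x => _) = rwavelet m l.+1 n k); first by split.
    by apply/funext => x; rewrite wavelet_systemE.
  rewrite (_ : (fun x => _) = fun=> 0).
    by split => //; apply: eq_integrableR integrableR0 => x; rewrite expr0n.
  by apply/funext => x; rewrite wavelet_systemE.
move=> f [/sqr_integrable_Lfun u2 /sqr_integrable_Lfun v2].
have -> : (\esum_(j in [set: 'I_m * int * int])
    (normc (L2_inner f (wavelet_system (@Gsystem R m) j)) ^+ 2)%:E =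
  frame_sum (@index_wavelet R m) (fun x => complex.Re (f x)) +
  frame_sum (@index_wavelet R m) (fun x => complex.Im (f x)))%E.
  rewrite -esumD; [|by move=> j _; rewrite lee_fin sqr_ge0|by move=> j _; rewrite lee_fin sqr_ge0].
  apply: eq_esum => -[[l n] k] _; rewrite -EFinD; congr _%:E.
  by apply: L2_inner_real => x; exact: wavelet_systemE.
rewrite L2_norm_sqr// -!EFinM !mulrDr !EFinD; split.
  by apply: leeD; exact: real_frame_lower.
by apply: leeD; exact: real_frame_upper.
Qed.

Lemma frame_error_cvg :
  scale_error m + frame_error m (Num.sqrt m%:R)^-1 @[m --> \oo] --> (0 : R).
Proof.
have [C C0 HC] := @scale_error_bounded R.
(* With s the scale error and q the square root of m, q times the total error is s q + (1 + s) + 16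
   s q^2, where s, s q and s q^2 are each at most [C]. *)
pose K := 1 + 18 * C; have K0 : 0 < K by rewrite /K; lra.
apply/cvgr0Pnorm_le => r r0; near=> m.
have m2 : (2 <= m)%N by near: m; exact: nbhs_infty_ge.
have mr : (K / r) ^+ 2 <= m%:R :> R by near: m; exact: nbhs_infty_ger.
pose q : R := Num.sqrt m%:R.
have qm : m%:R = q ^+ 2 :> R by rewrite sqr_sqrtr.
have q1 : 1 <= q by rewrite -[leLHS]sqrtr1 ler_wsqrtr// ler1n ltnW.
have qr : K / r <= q.
  by rewrite -[leLHS]ger0_norm ?divr_ge0 ?(ltW r0) ?(ltW K0)// -sqrtr_sqr ler_wsqrtr.
have q0 : 0 < q by exact: lt_le_trans q1.
have frame_errorE : frame_error m q^-1 = q^-1 * (1 + scale_error m) + 16 * scale_error m * q.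
  by rewrite /frame_error invrK.
rewrite -/q frame_errorE.
have := HC m m2; have := @scale_error_ge0 R m; move: (scale_error m) => s s0 h1.
have E : s + (q^-1 * (1 + s) + 16 * s * q) = q^-1 * (s * q + (1 + s) + 16 * (s * q ^+ 2)).
  by field; rewrite gt_eqF.
rewrite qm in h1; have h2 : s * q <= C by nra.
have h3 : 0 <= s * q by rewrite mulr_ge0// ltW.
have h4 : 0 <= s * q ^+ 2 by rewrite mulr_ge0// sqr_ge0.
rewrite E ger0_norm; last by rewrite mulr_ge0 ?invr_ge0 ?(ltW q0)//; lra.
rewrite ler_pdivrMl//; apply: (@le_trans _ _ K); first by rewrite /K; nra.
by rewrite -ler_pdivrMr.
Unshelve. all: by end_near. Qed.

End ComplexFrame.

Theorem theorem10 (R : realType) :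
  exists A B : nat -> R,
    [/\ exists M : nat, forall m : nat, (M <= m)%N ->
          is_frame (wavelet_system (@Gsystem R m)) (A m) (B m),
        A m @[m --> \oo] --> (1 : R) &
        B m @[m --> \oo] --> (1 : R)].
Proof.
pose e (m : nat) : R := (Num.sqrt m%:R)^-1.
pose E (m : nat) : R := scale_error m + frame_error m (e m).
have Ecvg : E m @[m --> \oo] --> (0 : R) by exact: frame_error_cvg.
exists (fun m => lower_bound m (e m)), (fun m => upper_bound m (e m)); split.
- move/cvgr0Pnorm_lt : Ecvg => /(_ 1 ltr01)[N _ HN].
  (* From [N] on the total error is below 1, which makes the lower bound positive; the scale
     estimates ask for [m] at least 2. *)
  exists (maxn N 2) => m; rewrite geq_max => /andP[Nm m2].
  apply: gaussian_frame => //.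
    by rewrite invr_gt0 sqrtr_gt0 ltr0n; lia.
  move: (HN m Nm); rewrite /= ltr_norml /E /lower_bound; lra.
- rewrite (_ : (fun m => lower_bound m (e m)) = fun m => 1 - E m).
    by rewrite -[X in _ --> X](subr0 1); apply: cvgB => //; exact: cvg_cst.
  by apply/funext => m; rewrite /lower_bound /E; ring.
- rewrite (_ : (fun m => upper_bound m (e m)) = fun m => 1 + E m).
    by rewrite -[X in _ --> X](addr0 1); apply: cvgD => //; exact: cvg_cst.
  by apply/funext => m; rewrite /upper_bound /E; ring.
Qed.
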